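(* Let $\Lambda\ge 3$ be an integer and let $(G,s,t)$ be a 2-terminal graph belonging to the class $\mathcal W$. If $G$ has maxmaxflow at most $\Lambda$, then every root $q\in\mathbb{C}$ of the chromatic polynomial $P_G(q)$ satisfies $|q-1| < (\Lambda-\log 2)/\log 2$.
   Context: Graphs are finite and undirected. For a graph $G=(V,E)$ the chromatic polynomial is $P_G(q)=\sum_{A\subseteq E} q^{k(A)}(-1)^{|A|}$, where $k(A)$ is the number of connected components of $(V,A)$. For distinct vertices $x,y$, $\lambda_G(x,y)$ is the maximum number of pairwise edge-disjoint $x$–$y$ paths, and the maxmaxflow is $\Lambda(G)=\max_{x\ne y}\lambda_G(x,y)$. A 2-terminal graph $(G,s,t)$ is a graph with two distinct distinguished vertices $s,t$ (the terminals). For 2-terminal graphs $(G_1,s_1,t_1),(G_2,s_2,t_2)$ on disjoint vertex sets, the parallel composition is obtained from $G_1\cup G_2$ by identifying $s_2$ with $s_1$ and $t_2$ with $t_1$, with terminals $s_1,t_1$; the series composition is obtained from $G_1\cup G_2$ by identifying $t_1$ with $s_2$, with terminals $s_1,t_2$. The Wheatstone bridge is the 2-terminal graph $(W,s,t)$ where $W=K_4$ minus one edge and $s,t$ are the two vertices of degree 2. The class $\mathcal W$ is the smallest class of 2-terminal graphs (up to isomorphism) that contains $K_2$ (with its two vertices as terminals) and the Wheatstone bridge and is closed under series and parallel composition. *)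

(* Defs.v *)
From Stdlib Require Import Reals.
From HB Require Import structures.
From mathcomp Require Import all_boot.

Unset Strict Implicit.
Unset Printing Implicit Defensive.

(* Vertices are 0, ..., nv-1; edges are an (ordered) list of unordered  *)
(* pairs of vertices (parallel edges allowed, as produced by parallel   *)
(* composition).                                                        *)
Record tgraph := TGraph {
  nv : nat;
  edges : seq (nat * nat);
  term_s : nat;
  term_t : nat }.

Definition K2 : tgraph := TGraph 2 [:: (0, 1)] 0 1.

(* Wheatstone bridge: K_4 minus the edge {0,3}; terminals 0 and 3 are
   the two vertices of degree 2. *)
Definition wheatstone : tgraph :=
  TGraph 4 [:: (0, 1); (0, 2); (1, 2); (1, 3); (2, 3)] 0 3.

(* parallel composition: s2 |-> s1, t2 |-> t1, other vertices of G2 are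
   relabelled to fresh vertices nv G1, nv G1 + 1, ... *)
Definition par_relabel (G1 G2 : tgraph) (v : nat) : nat :=
  if v == term_s G2 then term_s G1
  else if v == term_t G2 then term_t G1
  else nv G1 + (v - (term_s G2 < v) - (term_t G2 < v)).

Definition parallel (G1 G2 : tgraph) : tgraph :=
  TGraph (nv G1 + nv G2 - 2)
    (edges G1 ++ [seq (par_relabel G1 G2 e.1, par_relabel G1 G2 e.2) | e <- edges G2])
    (term_s G1) (term_t G1).

Definition ser_relabel (G1 G2 : tgraph) (v : nat) : nat :=
  if v == term_s G2 then term_t G1
  else nv G1 + (v - (term_s G2 < v)).

Definition series (G1 G2 : tgraph) : tgraph :=
  TGraph (nv G1 + nv G2 - 1)
    (edges G1 ++ [seq (ser_relabel G1 G2 e.1, ser_relabel G1 G2 e.2) | e <- edges G2])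
    (term_s G1) (ser_relabel G1 G2 (term_t G2)).

Definition norm_edge (e : nat * nat) : nat * nat := (minn e.1 e.2, maxn e.1 e.2).

Definition tg_iso (G H : tgraph) : Prop :=
  nv G = nv H /\
  exists f : nat -> nat,
    {in [pred v | v < nv G] &, injective f} /\
    {in [pred v | v < nv G], forall v, f v < nv H} /\
    f (term_s G) = term_s H /\ f (term_t G) = term_t H /\
    perm_eq [seq norm_edge (f e.1, f e.2) | e <- edges G]
            [seq norm_edge e | e <- edges H].

Inductive inW : tgraph -> Prop :=
| inW_K2 : inW K2
| inW_wheatstone : inW wheatstone
| inW_par G1 G2 : inW G1 -> inW G2 -> inW (parallel G1 G2)
| inW_ser G1 G2 : inW G1 -> inW G2 -> inW (series G1 G2)
| inW_iso G H : inW G -> tg_iso G H -> inW H.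

Definition nedges (G : tgraph) : nat := size (edges G).

Definition edge_at (G : tgraph) (i : 'I_(nedges G)) : nat * nat :=
  nth (0, 0) (edges G) i.

Definition sub_adj (G : tgraph) (A : {set 'I_(nedges G)}) : rel 'I_(nv G) :=
  fun x y => [exists i in A,
    (edge_at G i == (val x, val y)) || (edge_at G i == (val y, val x))].

Definition ncomp (G : tgraph) (A : {set 'I_(nedges G)}) : nat :=
  n_comp (sub_adj G A) (@predT 'I_(nv G)).

Fixpoint walk_vertices (v : nat) (ps : seq (nat * nat)) : option (seq nat) :=
  match ps with
  | [::] => Some [:: v]
  | e :: ps' =>
      if v == e.1 then omap (cons v) (walk_vertices e.2 ps')
      else if v == e.2 then omap (cons v) (walk_vertices e.1 ps')
      else None
  end.

Definition is_path (x y : nat) (ps : seq (nat * nat)) : bool :=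
  if walk_vertices x ps is Some vs then uniq vs && (last x vs == y) else false.

Definition is_path_set (G : tgraph) (x y : nat) (S : {set 'I_(nedges G)}) : bool :=
  has (fun p => is_path x y [seq edge_at G i | i <- p]) (permutations (enum S)).

Definition lambda (G : tgraph) (x y : nat) : nat :=
  \max_(F : {set {set 'I_(nedges G)}} |
          trivIset F && [forall S in F, is_path_set G x y S]) #|F|.

Definition maxmaxflow (G : tgraph) : nat :=
  \max_(x : 'I_(nv G)) \max_(y : 'I_(nv G) | x != y) lambda G (val x) (val y).

Definition cplx : Type := prod R R.
Definition C0 : cplx := (R0, R0).
Definition C1 : cplx := (R1, R0).
Definition Cadd (z w : cplx) : cplx := (Rplus z.1 w.1, Rplus z.2 w.2).
Definition Cmul (z w : cplx) : cplx :=
  (Rminus (Rmult z.1 w.1) (Rmult z.2 w.2), Rplus (Rmult z.1 w.2) (Rmult z.2 w.1)).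
Definition Cpow (z : cplx) (n : nat) : cplx := iter n (Cmul z) C1.
Definition Cmod (z : cplx) : R := sqrt (Rplus (Rsqr z.1) (Rsqr z.2)).
Definition Cminus_one : cplx := (Ropp R1, R0).

Definition chrom_eval (G : tgraph) (q : cplx) : cplx :=
  \big[Cadd/C0]_(A : {set 'I_(nedges G)})
     Cmul (Cpow Cminus_one #|A|) (Cpow q (ncomp G A)).

(* Main.v *)
Require Import Defs.
From Stdlib Require Import Reals.
From HB Require Import structures.
From mathcomp Require Import all_boot all_algebra.
From mathcomp Require Import zify Rstruct complex.
From mathcomp Require boolp ring.
From Stdlib Require Import Lra.
From Coquelicot Require Coquelicot.

(** Let S and D be the numbers of proper q-colourings of a 2-terminal network in
    which both terminals have prescribed colours, equal for S and distinct for D;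
    they are polynomials in q.  Parallel composition multiplies S and D, series
    composition multiplies M = S + (q - 1) D and N = S - D, and P_G = q M.
    Put Q = |q - 1| and suppose Q >= Lambda / log 2 - 1.  In a network that is
    closed up by a path between its terminals, and whose terminals are joined by
    k < Lambda edge-disjoint paths, either S = 0 or |N / M| <= r_k, where
    (1 + Q r_k) / (1 + r_k) = Y ^ k and Y ^ 2 = Q (Q + 1) / (Q ^ 2 - Q + 2): the
    value of Y is the least one that covers the Wheatstone bridge, and
    Y ^ (Lambda - 1) <= 2 Q / (Q + 1) means r_k <= 1 / Q.  If S = 0 then
    |N / M| = 1 / Q, hence every series composition has |N / M| <= 1 / Q ^ 2 <= r_1.
    In particular M never vanishes. *)

(** * Disjoint connections and maxmaxflow *)

Section Perm.

Lemma perm_map_inv {T U : eqType} (h : T -> U) s (t : seq T) :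
  perm_eq s (map h t) -> exists2 t', perm_eq t' t & map h t' = s.
Proof.
elim: s t => [|x s IH] t.
  move/perm_size; rewrite size_map /= => /esym/size0nil ->.
  by exists [::].
move=> pst.
have : x \in map h t by rewrite -(perm_mem pst) mem_head.
case/mapP=> y yt xE.
have pyt := perm_to_rem yt.
have : perm_eq s (map h (rem y t)).
  rewrite -(perm_cons x) {2}xE -map_cons.
  by apply: (perm_trans pst); apply: perm_map.
case/IH=> t' pt' mt'; exists (y :: t'); last by rewrite /= mt' -xE.
by apply: perm_trans (_ : perm_eq (y :: rem y t) t); rewrite ?perm_cons // perm_sym.
Qed.

End Perm.

Section Flow.

(* Connectivity through cuts: no 2-colouring that is constant along the edges
   separates x from y. *)
Definition conn {T : Type} (h : T -> nat * nat) (E : seq T) (x y : nat) : Prop :=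
  forall c : nat -> bool, all (fun e => c (h e).1 == c (h e).2) E -> c x = c y.

(** Connecting classes are split off one at a time up to permutation, so that parallel edges count
    with multiplicity. Edges are labels with endpoints given by [h], which serves both bare edge
    lists ([h = id]) and edge indices ([h = edge_at G]). *)
Fixpoint flow {T : eqType} (h : T -> nat * nat) (E : seq T) (x y k : nat) : Prop :=
  if k is k'.+1 then
    exists E1 E2, [/\ perm_eq (E1 ++ E2) E, conn h E1 x y & flow h E2 x y k']
  else True.

Lemma conn_perm {T : eqType} (h : T -> nat * nat) E E' x y :
  perm_eq E E' -> conn h E x y -> conn h E' x y.
Proof. by move=> pE cE c; rewrite -(perm_all _ pE); apply: cE. Qed.

Lemma conn_map {T U} (g : U -> T) (h : T -> nat * nat) E x y :
  conn h (map g E) x y <-> conn (h \o g) E x y.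
Proof. by split=> cE c; have := cE c; rewrite all_map. Qed.

Lemma conn_sym {T : eqType} (h : T -> nat * nat) E x y : conn h E x y -> conn h E y x.
Proof. by move=> cE c /cE. Qed.

Lemma conn_cat {T : eqType} (h : T -> nat * nat) E E' x y z :
  conn h E x y -> conn h E' y z -> conn h (E ++ E') x z.
Proof. by move=> c1 c2 c; rewrite all_cat => /andP[/c1-> /c2->]. Qed.

Lemma conn_catl {T : eqType} (h : T -> nat * nat) E E' x y : conn h E x y -> conn h (E ++ E') x y.
Proof. by move=> c1 c; rewrite all_cat => /andP[/c1]. Qed.

Lemma flow_perm {T : eqType} (h : T -> nat * nat) E E' x y k :
  perm_eq E E' -> flow h E x y k -> flow h E' x y k.
Proof.
case: k => //= k pE [E1 [E2 [p c f]]]; exists E1, E2; split=> //.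
exact: perm_trans pE.
Qed.

Lemma flow_map {T U : eqType} (g : U -> T) (h : T -> nat * nat) E x y k :
  flow h (map g E) x y k <-> flow (h \o g) E x y k.
Proof.
elim: k E => //= k IH E; split.
  case=> E1 [E2 [/perm_map_inv[E' pE' mE'] c f]].
  have := take_size_cat E2 (erefl (size E1)); rewrite -mE' -map_take => e1.
  have := drop_size_cat E2 (erefl (size E1)); rewrite -mE' -map_drop => e2.
  exists (take (size E1) E'), (drop (size E1) E'); split.
  - by rewrite cat_take_drop.
  - by apply/conn_map; rewrite e1.
  - by apply/IH; rewrite e2.
case=> E1 [E2 [p c f]]; exists (map g E1), (map g E2); split.
- by rewrite -map_cat; apply: perm_map.
- exact/conn_map.
- exact/IH.
Qed.

Lemma flow_cat {T : eqType} (h : T -> nat * nat) E E' x y k l :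
  flow h E x y k -> flow h E' x y l -> flow h (E ++ E') x y (k + l).
Proof.
elim: k E => [|k IH] E /=.
  case: l => //= l _ [E1 [E2 [p c f]]]; exists (E1 ++ E), E2; split=> //.
    by rewrite -catA perm_catCA perm_cat2l.
  by apply: conn_catl.
case=> E1 [E2 [p c f]] f'; exists E1, (E2 ++ E'); split=> //; last exact: IH.
by rewrite catA perm_cat2r.
Qed.

Lemma flowW {T : eqType} (h : T -> nat * nat) E E' x y k :
  flow h E x y k -> flow h (E ++ E') x y k.
Proof. by move=> f; rewrite -(addn0 k); apply: flow_cat. Qed.

Lemma flow_le {T : eqType} (h : T -> nat * nat) E x y k l :
  l <= k -> flow h E x y k -> flow h E x y l.
Proof.
elim: k l E => [|k IH] [|l] E //= lk [E1 [E2 [p c f]]].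
by exists E1, E2; split=> //; apply: IH f.
Qed.

Lemma flow_sym {T : eqType} (h : T -> nat * nat) E x y k : flow h E x y k -> flow h E y x k.
Proof.
elim: k E => //= k IH E [E1 [E2 [p c f]]]; exists E1, E2; split=> //.
  exact: conn_sym.
exact: IH.
Qed.

Lemma flow_conn_trans {T : eqType} (h : T -> nat * nat) E E' x y z k :
  flow h E x y k -> flow h E' y z k -> flow h (E ++ E') x z k.
Proof.
elim: k E E' => //= k IH E E' [E1 [E2 [p c f]]] [F1 [F2 [q d g]]].
exists (E1 ++ F1), (E2 ++ F2); split; last exact: IH.
  rewrite -catA perm_sym; apply: (perm_trans (y := (E1 ++ E2) ++ (F1 ++ F2))).
    by rewrite perm_sym perm_cat.
  by rewrite -catA perm_cat2l perm_catCA.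
exact: conn_cat d.
Qed.

Lemma conn_subst {T : eqType} (h : T -> nat * nat) e E E' x y :
  conn h E' (h e).1 (h e).2 -> conn h (e :: E) x y -> conn h (E' ++ E) x y.
Proof.
move=> cE' c1 c; rewrite all_cat => /andP[/cE' h1 h2].
by apply: c1; rewrite /= h1 eqxx.
Qed.

(** One occurrence of [e] lies either in a single connecting class or among the leftovers. Replacing
    it there by [E'] keeps the classes disjoint, and that class stays connecting because [E'] joins
    the ends of [e]. *)
Lemma flow_subst {T : eqType} (h : T -> nat * nat) e E E' x y k :
  conn h E' (h e).1 (h e).2 -> flow h (e :: E) x y k -> flow h (E' ++ E) x y k.
Proof.
move=> cE'; elim: k E => //= k IH E [E1 [E2 [p c f]]].
have : e \in E1 ++ E2 by rewrite (perm_mem p) mem_head.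
rewrite mem_cat => /orP[] ein.
  exists (E' ++ rem e E1), E2; split=> //.
    rewrite -catA perm_cat2l -(perm_cons e) -cat_cons.
    apply: perm_trans p; rewrite perm_cat2r perm_sym; exact: perm_to_rem.
  apply: conn_subst cE' _; apply: conn_perm c; exact: perm_to_rem.
exists E1, (E' ++ rem e E2); split=> //.
  rewrite perm_catCA perm_cat2l -(perm_cons e) -cat1s perm_catCA cat1s.
  apply: perm_trans p; rewrite perm_cat2l perm_sym; exact: perm_to_rem.
apply: IH; apply: flow_perm f; exact: perm_to_rem.
Qed.

Definition verts (E : seq (nat * nat)) : seq nat := map fst E ++ map snd E.

(** The cut to test is the indicator of x: were x on no edge, it would be constant along all edges
    and still separate x from y. *)
Lemma conn_verts E x y : x != y -> conn id E x y -> x \in verts E.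
Proof.
move=> xy /(_ (fun v => v == x)); rewrite eqxx eq_sym (negPf xy).
case: (boolP (all _ E)) => [_ /(_ isT)//|/allPn[e eE ne] _].
rewrite /verts mem_cat.
case: (e.1 =P x) ne => [<- _|_]; first by rewrite (map_f fst).
by case: (e.2 =P x) => // <- _; rewrite (map_f snd) ?orbT.
Qed.

Lemma flow_verts E x y k : x != y -> 0 < k -> flow id E x y k -> x \in verts E.
Proof.
case: k => //= k xy _ [E1 [E2 [p c f]]].
have := @conn_verts _ _ _ xy c; rewrite /verts !mem_cat.
have sub : {subset E1 <= E} by move=> e ee; rewrite -(perm_mem p) mem_cat ee.
by case/orP=> /mapP[e /sub ee ->]; rewrite map_f ?orbT.
Qed.

(** The bound on maxmaxflow for a bare edge list, with x and y ranging over all naturals; virtual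
    edges can then be added without building a graph. *)
Definition cap (E : seq (nat * nat)) (L : nat) : Prop :=
  forall x y k, x != y -> flow id E x y k -> k <= L.

Definition emap (f : nat -> nat) (e : nat * nat) := (f e.1, f e.2).

Lemma flow_emap f E x y k : flow id E x y k -> flow id (map (emap f) E) (f x) (f y) k.
Proof.
elim: k E => //= k IH E [E1 [E2 [p c g]]].
exists (map (emap f) E1), (map (emap f) E2); split; last exact: IH.
  by rewrite -map_cat perm_map.
move=> d; rewrite all_map => a; exact: (c (d \o f)).
Qed.

(** Flows push forward along [f]. The ends of a positive flow lie on edges, where [f] is injective,
    so they stay distinct. *)
Lemma cap_emap f E L : {in verts E &, injective f} ->
  cap (map (emap f) E) L -> cap E L.
Proof.
move=> fI cE x y [|k] // xy fl.
apply: (cE (f x) (f y)); last exact: flow_emap.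
have xE := @flow_verts _ _ _ k.+1 xy isT fl.
have yE : y \in verts E.
  by apply: (@flow_verts _ _ _ k.+1 _ isT (flow_sym _ _ _ _ _ fl)); rewrite eq_sym.
by apply: contra xy => /eqP/fI->.
Qed.

Lemma conn_norm E x y : conn norm_edge E x y <-> conn id E x y.
Proof.
suff e (c : nat -> bool) : all (fun e => c (norm_edge e).1 == c (norm_edge e).2) E
         = all (fun e => c e.1 == c e.2) E.
  by split=> h c; have := h c; rewrite e.
apply: eq_all => -[a b] /=; rewrite /norm_edge /=.
by case: (leqP a b) => ab; rewrite // eq_sym.
Qed.

Lemma flow_norm E x y k : flow norm_edge E x y k <-> flow id E x y k.
Proof.
by elim: k E => //= k IH E; split=> -[E1 [E2 [p c f]]]; exists E1, E2;
  split=> //; (try exact/conn_norm); exact/IH.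
Qed.

Lemma flow_norm_perm E E' x y k :
  perm_eq (map norm_edge E) (map norm_edge E') ->
  flow id E x y k -> flow id E' x y k.
Proof.
move=> p f; apply/flow_norm.
apply: (iffLR (flow_map norm_edge id _ _ _ _)); apply: flow_perm p _.
by apply/flow_map/flow_norm.
Qed.

Lemma cap_norm_perm E E' L :
  perm_eq (map norm_edge E) (map norm_edge E') -> cap E' L -> cap E L.
Proof. by move=> p c x y k xy /(flow_norm_perm _ _ _ _ _ p); apply: c. Qed.

Lemma cap_catl E E' L : cap (E ++ E') L -> cap E L.
Proof. by move=> c x y k xy f; apply: c xy _; apply: flowW. Qed.

Lemma cap_perm E E' L : perm_eq E E' -> cap E L -> cap E' L.
Proof. by move=> p; apply: cap_norm_perm; apply: perm_map; rewrite perm_sym. Qed.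

(** A subnetwork joining the ends of [e] can be traded for the single edge [e]. This turns the rest
    of a graph into a virtual edge between the terminals of one of its parts. *)
Lemma cap_subst e E E' L :
  conn id E' e.1 e.2 -> cap (E' ++ E) L -> cap (e :: E) L.
Proof. by move=> cE c x y k xy f; apply: c xy _; apply: flow_subst f. Qed.

End Flow.

(** * Simple paths inside connecting edge sets, and the comparison of [flow] with [lambda] *)

Section Lambda.

Lemma walk_head u ps vs : walk_vertices u ps = Some vs -> vs = u :: behead vs.
Proof.
case: ps => [|e ps] /=; first by case=> <-.
case: eqP => _; first by case: walk_vertices => // ws [<-].
by case: eqP => // _; case: walk_vertices => // ws [<-].
Qed.

Lemma walk_drop u ps vs v :
  walk_vertices u ps = Some vs -> v \in vs ->
  exists2 k, k <= size ps & walk_vertices v (drop k ps) = Some (drop k vs).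
Proof.
elim: ps u vs => [|e ps IH] u vs /=.
  by case=> <-; rewrite inE => /eqP->; exists 0.
have aux w : omap (cons u) (walk_vertices w ps) = Some vs -> v \in vs ->
  (if u == e.1 then w = e.2 else (u == e.2) /\ w = e.1) ->
  exists2 k, k <= (size ps).+1 & walk_vertices v (drop k (e :: ps)) = Some (drop k vs).
  case E: (walk_vertices w ps) => [ws|] //= [<-]; rewrite inE => /orP[/eqP-> h|vw _].
    exists 0 => //; rewrite !drop0 /=; move: h.
    by case: eqP => [_ <-|_ [-> <-]]; rewrite E.
  by have [k ks kE] := IH _ _ E vw; exists k.+1.
case: eqP => [ue h vin|ue]; first by apply: (aux e.2) => //; rewrite ue eqxx.
by case: eqP => // ue' h vin; apply: (aux e.1) => //; case: ifP => [/eqP//|_]; rewrite ue' eqxx.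
Qed.

Lemma walk_ends u ps vs e :
  walk_vertices u ps = Some vs -> e \in ps -> (e.1 \in vs) && (e.2 \in vs).
Proof.
elim: ps u vs => [|f ps IH] u vs //=.
have hd w ws : walk_vertices w ps = Some ws -> w \in ws.
  by move/walk_head->; rewrite mem_head.
have aux w : omap (cons u) (walk_vertices w ps) = Some vs ->
   (u == f.1) && (w == f.2) || (u == f.2) && (w == f.1) -> e \in f :: ps ->
   (e.1 \in vs) && (e.2 \in vs).
  case E: (walk_vertices w ps) => [ws|] //= [<-] h; rewrite !inE => /orP[/eqP->|ein].
    case/orP: h => /andP[/eqP<- /eqP<-]; rewrite eqxx (hd _ _ E) /= ?orbT //.
  by have /andP[-> ->] := IH _ _ E ein; rewrite !orbT.
case: eqP => [ue h|_]; first by apply: (aux f.2); rewrite // ue !eqxx.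
by case: eqP => // ue' h; apply: (aux f.1); rewrite // ue' !eqxx orbT.
Qed.

Variables (I : eqType) (h : I -> nat * nat).

(** Colour a vertex by whether a simple path in E leads from it to y. This colouring is constant
    along the edges of E and true at y, hence true at x. *)
Lemma conn_path (E : seq I) x y : conn h E x y ->
  exists p : seq I, [/\ uniq p, {subset p <= E} & is_path x y (map h p)].
Proof.
move=> cE.
pose good v (p : seq I) := [/\ uniq p, {subset p <= E} & is_path v y (map h p)].
suff : boolp.asbool (exists p, good x p) by move/boolp.asboolP.
rewrite (cE (fun v => boolp.asbool (exists p, good v p))); first apply/boolp.asboolP.
  by exists [::]; split=> //; rewrite /is_path /= eqxx.
(* A path from u is cut at v if it already visits v; otherwise i is put in front. In the second case
   i is new, since a path through i would visit v. *)
have step i u v : i \in E -> h i = (u, v) \/ h i = (v, u) ->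
    (exists p, good u p) -> exists p, good v p.
  move=> iE hi [p [up sp]]; rewrite /is_path.
  case W: walk_vertices => [vs|] // /andP[uvs /eqP lvs].
  case: (boolP (v \in vs)) => [vvs|vNvs].
    have [k ks W'] := walk_drop _ _ _ _ W vvs.
    exists (drop k p); split; first exact: drop_uniq.
      by move=> j /mem_drop/sp.
    rewrite /is_path map_drop W' drop_uniq //= -lvs.
    have := cat_take_drop k vs; rewrite (walk_head _ _ _ W') => dE.
    by rewrite -[in X in _ == X]dE last_cat.
  exists (i :: p); split.
  - rewrite /= up andbT; apply: contra vNvs => ip.
    have /andP[] := walk_ends _ _ _ _ W (map_f h ip).
    by case: hi => -> /=.
  - by move=> j; rewrite inE => /orP[/eqP->|/sp].
  rewrite /is_path /=.
  have -> : (if v == (h i).1 then omap (cons v) (walk_vertices (h i).2 [seq h i | i <- p])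
     else if v == (h i).2 then omap (cons v) (walk_vertices (h i).1 [seq h i | i <- p]) else None)
     = Some (v :: vs).
    case: hi => -> /=; rewrite eqxx; last by rewrite W.
    by case: eqP => [->|_]; rewrite W.
  by rewrite /= vNvs uvs /= -lvs (walk_head _ _ _ W).
apply/allP=> i iE; apply/eqP.
case hE: (h i) => [a b] /=; apply/boolp.asboolP/boolp.asboolP;
  apply: (step i) => //; rewrite hE; by [left|right].
Qed.

End Lambda.

Lemma flow_lambda (G : tgraph) x y k :
  x != y -> flow id (edges G) x y k -> k <= lambda G x y.
Proof.
move=> xy.
(* Passing to edge indices makes parallel edges distinct, as the sets counted by [lambda]
   require. *)
have <- : map (edge_at G) (enum 'I_(nedges G)) = edges G.
  apply: (@eq_from_nth _ (0, 0)); rewrite size_map size_enum_ord // => i iN.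
  by rewrite (nth_map (Ordinal iN)) ?size_enum_ord // /edge_at nth_enum_ord.
move/flow_map.
have : uniq (enum 'I_(nedges G)) by exact: enum_uniq.
move: (enum _) => E uE fl.
(* The induction also keeps the members of F nonempty and inside E, so that the next path is
   disjoint from all of them and enlarges F by one. *)
suff [F [cF tF pF sF]] : exists F : {set {set 'I_(nedges G)}},
  [/\ #|F| = k, trivIset F, [forall S in F, is_path_set G x y S] &
      forall S, S \in F -> S != set0 /\ S \subset [set i in E]].
  by rewrite -cF /lambda; apply: (@leq_bigmax_cond _ _ (fun F : {set {set _}} => #|F|)); rewrite tF.
elim: k E uE fl => [|k IH] E uE /=.
  exists set0; rewrite cards0; split=> //.
  - by apply/trivIsetP=> A B; rewrite inE.
  - by apply/forall_inP=> S; rewrite inE.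
  - by move=> S; rewrite inE.
case=> E1 [E2 [p c f]].
have : uniq (E1 ++ E2) by rewrite (perm_uniq p).
rewrite cat_uniq => /and3P[u1 d12 u2].
have [F [cF tF pF sF]] := IH _ u2 f.
have [q [uq sq pq]] := conn_path _ _ _ _ _ c.
have [i0 i0q] : exists i, i \in q.
  case: (q) pq => [|i ? _]; first by rewrite /is_path /= (negPf xy).
  by exists i; rewrite mem_head.
pose S := [set i in q].
have S0 : S != set0 by apply/set0Pn; exists i0; rewrite inE.
have dSF B : B \in F -> [disjoint S & B].
  move=> BF; have [_ /subsetP sB] := sF _ BF.
  rewrite disjoint_subset; apply/subsetP=> i; rewrite !inE => /sq iE1.
  apply/negP=> /sB; rewrite inE => iE2.
  by case/hasP: d12; exists i.
have N0 : set0 \notin F by apply/negP=> /sF[]; rewrite eqxx.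
have [tF' SF] := trivIsetU1 dSF tF N0.
exists (S |: F); split=> //.
- by rewrite cardsU1 SF cF.
- apply/forall_inP=> B; rewrite !inE => /orP[/eqP->|BF]; last exact: (forall_inP pF).
  apply/hasP; exists q; last exact: pq.
  rewrite mem_permutations; apply: uniq_perm; rewrite ?enum_uniq //.
  by move=> i; rewrite mem_enum inE.
- move=> B; rewrite !inE => /orP[/eqP->|/sF[-> sB]]; split=> //.
    by apply/subsetP=> i; rewrite !inE => /sq iE; rewrite -(perm_mem p) mem_cat iE.
  apply: (subset_trans sB); apply/subsetP=> i; rewrite !inE => iE.
  by rewrite -(perm_mem p) mem_cat iE orbT.
Qed.

(** * Zero-free regions *)

Inductive wtree : Type :=
| TK2 | TWheat | TPar of wtree & wtree | TSer of wtree & wtree.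

(** The number of edge-disjoint paths between the terminals, as realised by the second clause of
    [tree_of]. *)
Fixpoint width (t : wtree) : nat :=
  match t with
  | TK2 => 1
  | TWheat => 2
  | TPar t1 t2 => width t1 + width t2
  | TSer t1 t2 => minn (width t1) (width t2)
  end.

Lemma width_gt0 t : 0 < width t.
Proof. elim: t => //= t1 IH1 t2 IH2; lia. Qed.

(* [open_ok L t] bounds the widths of the parallel subnetworks of [t] as forced by
   maxmaxflow at most L; [closed_ok L t] is the stronger bound forced when the
   terminals are moreover joined by a path outside the network. *)
Fixpoint closed_ok (L : nat) (t : wtree) : Prop :=
  match t with
  | TPar t1 t2 => [/\ closed_ok L t1, closed_ok L t2 & width t1 + width t2 < L]
  | TSer t1 t2 => closed_ok L t1 /\ closed_ok L t2
  | _ => True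
  end.

Fixpoint open_ok (L : nat) (t : wtree) : Prop :=
  match t with
  | TPar t1 t2 => closed_ok L t1 /\ closed_ok L t2
  | TSer t1 t2 => open_ok L t1 /\ open_ok L t2
  | _ => True
  end.

Lemma closed_ok_width L t : 3 <= L -> closed_ok L t -> width t < L.
Proof.
move=> L3; elim: t => [|//|t1 _ t2 _ []//|t1 IH1 t2 IH2 [/IH1 h1 _]] /=; lia.
Qed.

Module Analytic.
Import Coquelicot.Coquelicot.

(** * Logarithm estimates and the bound on powers of Y *)

Section ElementaryBounds.
Local Open Scope R_scope.

(** The difference of the two sides vanishes at 1 and has derivative (1 - 1/x)^2 / 2, so the mean
    value theorem applies. *)
Lemma ln_le_half_diff y : 1 <= y -> ln y <= (y - / y) / 2.
Proof.
move=> y1.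
pose f x := (x - / x) / 2 - ln x.
pose df x := (1 - / x) ^ 2 / 2.
have df_f x : 1 <= x -> is_derive f x (df x).
  move=> x1; rewrite /f /df; auto_derive; first by split; lra.
  by field; lra.
have [y_1|y_1] := Req_dec y 1.
  rewrite y_1 ln_1 Rinv_1; lra.
have [c [c1 [_ fE]]] : exists c, 1 <= c /\ c <= y /\ f y = f 1 + df c * (y - 1).
  apply: MVT_cor3; first by lra.
  by move=> c c1 _; exact/is_derive_Reals/df_f.
have f1 : f 1 = 0 by rewrite /f ln_1 Rinv_1; lra.
have dfc : 0 <= df c by rewrite /df; have := pow2_ge_0 (1 - / c); lra.
have : 0 <= f y by rewrite fE f1; nra.
rewrite /f; lra.
Qed.

(** From 1 + x <= exp x at x = -1/10: exp (6/10) <= (10/9)^6 < 2. The upper bound [ln2_le] uses exp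
    (3/4) >= (9/8)^6 > 2 in the same way. *)
Lemma ln2_ge : 6 / 10 <= ln 2.
Proof.
rewrite -(ln_exp (6 / 10)); apply: ln_le; first exact: exp_pos.
have h : 9 / 10 <= exp (- (1 / 10)) by have := exp_ineq1_le (- (1 / 10)); lra.
have e : exp (6 / 10) * (exp (- (1 / 10)) ^ 6) = 1.
  by rewrite /= Rmult_1_r -!exp_plus -[RHS]exp_0; congr exp; field.
have : (9 / 10) ^ 6 <= exp (- (1 / 10)) ^ 6 by apply: pow_incr; lra.
have := exp_pos (6 / 10); nra.
Qed.

Lemma ln2_le : ln 2 <= 3 / 4.
Proof.
rewrite -(ln_exp (3 / 4)); apply: ln_le; first lra.
have h : 9 / 8 <= exp (1 / 8) by have := exp_ineq1_le (1 / 8); lra.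
have -> : exp (3 / 4) = exp (1 / 8) ^ 6.
  by rewrite /= Rmult_1_r -!exp_plus; congr exp; field.
have : (9 / 8) ^ 6 <= exp (1 / 8) ^ 6 by apply: pow_incr; lra.
lra.
Qed.

(** The value of (1 + Q r) / (1 + r) at r = 2 / (Q (Q - 1)), the largest |N / M| that the Wheatstone
    bridge can have. *)
Definition yW Q := Q * (Q + 1) / (Q ^ 2 - Q + 2).

Lemma yW_ge1 Q : 3 <= Q -> 1 <= yW Q.
Proof. by move=> Q3; apply/Rle_div_r; nra. Qed.

(** In logarithms the claim is (n/2) ln (yW Q) <= ln 2 - ln (1 + 1/Q). Both logarithms on rational
    arguments are estimated by [ln_le_half_diff], which leaves an inequality between rational
    functions of Q and ln 2. *)
Lemma yW_pow_bound (n : nat) Q : 3 <= Q -> INR n + 1 <= (Q + 1) * ln 2 ->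
  sqrt (yW Q) ^ n <= 2 * Q / (Q + 1).
Proof.
move=> Q3 nQ; have y1 := yW_ge1 Q Q3.
have sy0 : 0 < sqrt (yW Q) by apply: sqrt_lt_R0; lra.
have rhs0 : 0 < 2 * Q / (Q + 1) by apply: Rdiv_lt_0_compat; lra.
rewrite -(exp_ln (sqrt _ ^ n)); last exact: pow_lt.
rewrite -(exp_ln (2 * Q / (Q + 1))) //.
suff [/exp_increasing /Rlt_le //|->] : ln (sqrt (yW Q) ^ n) <= ln (2 * Q / (Q + 1)).
  exact: Rle_refl.
rewrite -Rpower_pow // ln_Rpower -Rpower_sqrt ?ln_Rpower; last lra.
have -> : 2 * Q / (Q + 1) = 2 * / (1 + / Q) by field; lra.
have iQ : 0 < / Q by apply: Rinv_0_lt_compat; lra.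
rewrite ln_mult; [|lra|by apply: Rinv_0_lt_compat; lra].
rewrite ln_Rinv; last lra.
have := ln_le_half_diff (1 + / Q) ltac:(lra).
have := ln_le_half_diff _ y1.
set lQ := ln (1 + / Q); set ly := ln (yW Q); set l2 := ln 2 in nQ *.
have D0 : 0 < Q ^ 2 - Q + 2 by nra.
(* The half-difference estimates give ln (yW Q) / 2 <= b and ln (1 + 1/Q) <= a. *)
pose b := (Q - 1) * (Q ^ 2 + 1) / ((Q ^ 2 + Q) * (Q ^ 2 - Q + 2)).
pose a := (2 * Q + 1) / (2 * Q * (Q + 1)).
have -> : (yW Q - / yW Q) / 2 = 2 * b by rewrite /yW /b; field; split; nra.
have -> : (1 + / Q - / (1 + / Q)) / 2 = a by rewrite /a; field; split; nra.
have b0 : 0 <= b by apply: Rdiv_le_0_compat; nra.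
have bE : (Q + 1) * b - 1 = - ((Q + 1) / (Q * (Q ^ 2 - Q + 2))).
  by rewrite /b; field; split; nra.
have abE : a - b = (Q ^ 2 + Q + 4) / (2 * Q * (Q + 1) * (Q ^ 2 - Q + 2)).
  by rewrite /a /b; field; split; nra.
(* After clearing denominators this is Q^2 + Q + 4 <= (6/5) (Q + 1)^2, true for Q >= 3. With (Q + 1)
   b = 1 - g and n <= (Q + 1) ln 2 - 1, what remains to be shown is a - b <= g ln 2, and 6/10 <= ln
   2. *)
have key : a - b <= 6 / 10 * ((Q + 1) / (Q * (Q ^ 2 - Q + 2))).
  have -> : 6 / 10 * ((Q + 1) / (Q * (Q ^ 2 - Q + 2))) =
    (6 / 10 * (2 * (Q + 1) ^ 2)) / (2 * Q * (Q + 1) * (Q ^ 2 - Q + 2)).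
    by field; split; nra.
  rewrite abE; apply: Rmult_le_compat_r; last nra.
  by apply/Rlt_le/Rinv_0_lt_compat/Rmult_lt_0_compat => //; nra.
have g0 : 0 <= (Q + 1) / (Q * (Q ^ 2 - Q + 2)) by apply: Rdiv_le_0_compat; nra.
move: bE key g0; set g := (Q + 1) / _ => bE key g0 lyb lQa.
have l2_ge : 6 / 10 <= l2 := ln2_ge.
have n0 := pos_INR n.
have h1 : INR n * (/ 2 * ly) <= INR n * b by nra.
have h2 : INR n * b <= ((Q + 1) * l2 - 1) * b by nra.
have h3 : ((Q + 1) * l2 - 1) * b = l2 * (1 - g) - b.
  by rewrite -[1 - g]/(1 + - g) -bE; ring.
have h4 : 6 / 10 * g <= l2 * g by nra.
lra.
Qed.

End ElementaryBounds.

(** * Transmissivities under series and parallel composition *)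

Local Open Scope C_scope.

(** The pair (S, D). In a series composition the middle vertex takes the colour of an end or one of
    the remaining q - 1 (equal ends) or q - 2 (distinct ends) colours. *)
Fixpoint Csd (q : C) (t : wtree) : C * C :=
  match t with
  | TK2 => (RtoC 0, RtoC 1)
  | TWheat => ((q - 1) * (q - 2), (q - 2) * (q - 3))
  | TPar t1 t2 => ((Csd q t1).1 * (Csd q t2).1, (Csd q t1).2 * (Csd q t2).2)
  | TSer t1 t2 =>
      let: (S1, D1) := Csd q t1 in let: (S2, D2) := Csd q t2 in
      (S1 * S2 + (q - 1) * (D1 * D2), S1 * D2 + D1 * S2 + (q - 2) * (D1 * D2))
  end.

(* M and N are the values at q of P_G / q and of S - D; the quotient N / M is
   the effective transmissivity of the network. *)
Definition CM (q : C) (t : wtree) : C := (Csd q t).1 + (q - 1) * (Csd q t).2.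
Definition CN (q : C) (t : wtree) : C := (Csd q t).1 - (Csd q t).2.

(** M and N are the eigenvalues of the transfer matrix with S on the diagonal and D off it; series
    composition is the product of these commuting matrices. *)
Lemma CM_ser q t1 t2 : CM q (TSer t1 t2) = CM q t1 * CM q t2.
Proof. by rewrite /CM /=; case: (Csd q t1) (Csd q t2) => [S1 D1] [S2 D2] /=; ring. Qed.

Lemma CN_ser q t1 t2 : CN q (TSer t1 t2) = CN q t1 * CN q t2.
Proof. by rewrite /CN /=; case: (Csd q t1) (Csd q t2) => [S1 D1] [S2 D2] /=; ring. Qed.

(** Inverting the change of variables gives q S = M + (q - 1) N and q D = M - N; parallel
    composition multiplies S and D. The factor q on the left avoids a division. *)
Lemma CM_par q t1 t2 :
  q * CM q (TPar t1 t2) = CM q t1 * CM q t2 + (q - 1) * (CN q t1 * CN q t2).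
Proof. by rewrite /CM /CN /=; case: (Csd q t1) (Csd q t2) => [S1 D1] [S2 D2] /=; ring. Qed.

Lemma CN_par q t1 t2 :
  q * CN q (TPar t1 t2) =
  CN q t1 * CM q t2 + CM q t1 * CN q t2 + (q - 2) * (CN q t1 * CN q t2).
Proof. by rewrite /CM /CN /=; case: (Csd q t1) (Csd q t2) => [S1 D1] [S2 D2] /=; ring. Qed.

(** * Zero-free regions at a fixed q, with n in the role of Lambda - 1 *)

Section Regions.
Local Open Scope R_scope.
Variables (q : C) (n : nat).
Let Q := Cmod (q - 1)%C.
Let Y := sqrt (yW Q).
Hypotheses (Q3 : 3 <= Q) (Yn : Y ^ n <= 2 * Q / (Q + 1)).

(* The solution r of (1 + Q r) / (1 + r) = Y ^ k; the left-hand side is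
   multiplicative under parallel connection in the worst case. *)
Definition rad (k : nat) : R := (Y ^ k - 1) / (Q - Y ^ k).

Let Y1 : 1 <= Y.
Proof. by rewrite -sqrt_1; apply/sqrt_le_1_alt/yW_ge1. Qed.

Let Yk_ge1 k : 1 <= Y ^ k.
Proof. exact: pow_R1_Rle. Qed.

Let Yk_le k : (k <= n)%coq_nat -> Y ^ k <= 2 * Q / (Q + 1).
Proof. by move=> kn; apply: Rle_trans Yn; apply: Rle_pow. Qed.

Let bound_lt2 : 2 * Q / (Q + 1) < 2.
Proof. by apply/Rlt_div_l; lra. Qed.

Lemma rad_mono k l : (k <= l)%coq_nat -> (l <= n)%coq_nat -> rad k <= rad l.
Proof.
move=> kl ln; have yl := Yk_le _ ln; have yk : Y ^ k <= Y ^ l by apply: Rle_pow.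
have := Yk_ge1 k => y1; rewrite /rad.
have -> : (Y ^ l - 1) / (Q - Y ^ l) =
  (Y ^ k - 1) / (Q - Y ^ k) + (Q - 1) * (Y ^ l - Y ^ k) / ((Q - Y ^ l) * (Q - Y ^ k)).
  by field; lra.
have : 0 <= (Q - 1) * (Y ^ l - Y ^ k) / ((Q - Y ^ l) * (Q - Y ^ k)).
  by apply: Rdiv_le_0_compat; nra.
lra.
Qed.

Lemma rad_ge0 k : (k <= n)%coq_nat -> 0 <= rad k.
Proof.
move=> kn; have := Yk_le _ kn; have := Yk_ge1 k => *.
by apply: Rdiv_le_0_compat; lra.
Qed.

(** Cleared of denominators this is Y^k (Q + 1) <= 2 Q, the hypothesis on Y^n weakened to k <= n. *)
Lemma rad_leV k : (k <= n)%coq_nat -> rad k <= / Q.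
Proof.
move=> kn; have := Yk_le _ kn; have := Yk_ge1 k => y1 yk.
rewrite -[/ Q]Rmult_1_l; apply/Rle_div_l; first lra.
rewrite Rmult_comm -Rmult_assoc; apply/Rle_div_r; first lra.
have : Y ^ k * (Q + 1) <= 2 * Q by apply/Rle_div_r; lra.
lra.
Qed.

(** For r = (a + b + (Q + 1) a b) / (1 - Q a b), both 1 + Q r and 1 + r factor, up to the same
    denominator, into their values at a and b, so (1 + Q r) / (1 + r) is multiplicative. This r is
    the worst case of [CN_par] over [CM_par] when |q - 2| <= Q + 1. *)
Lemma rad_add k l : (k + l <= n)%coq_nat ->
  rad k + rad l + (Q + 1) * (rad k * rad l) = rad (k + l) * (1 - Q * (rad k * rad l)).
Proof.
move=> kln.
have yk : Y ^ k <= 2 * Q / (Q + 1) by apply: Yk_le; lia.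
have yl : Y ^ l <= 2 * Q / (Q + 1) by apply: Yk_le; lia.
have := Yk_le _ kln; rewrite /rad pow_add.
move: (Yk_ge1 k) (Yk_ge1 l) => *; field; lra.
Qed.

Let Ysq : Y ^ 2 = yW Q.
Proof. by rewrite /Y /= Rmult_1_r sqrt_sqrt //; have := yW_ge1 Q Q3; lra. Qed.

(** Solving for Y, the claim is Y >= Q (Q + 1) / (Q^2 + 1). The square of the right-hand side falls
    short of [yW Q] by a nonnegative multiple of (Q - 1)^2. *)
Lemma rad1 : (1 <= n)%coq_nat -> / Q * / Q <= rad 1.
Proof.
move=> n1; rewrite /rad.
have := Yk_le _ n1; have := Yk_ge1 1; rewrite pow_1 => _ Y2.
have D0 : 0 < Q ^ 2 - Q + 2 by nra.
have Q20 : 0 < Q ^ 2 + 1 by nra.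
have z : Q * (Q + 1) / (Q ^ 2 + 1) <= Y.
  apply: Rsqr_incr_0_var; last lra.
  rewrite !Rsqr_pow2 Ysq /yW.
  have -> : (Q * (Q + 1) / (Q ^ 2 + 1)) ^ 2 =
     Q * (Q + 1) / (Q ^ 2 - Q + 2) -
     Q * (Q + 1) * (Q - 1) ^ 2 / ((Q ^ 2 - Q + 2) * (Q ^ 2 + 1) ^ 2).
    by field; lra.
  suff : 0 <= Q * (Q + 1) * (Q - 1) ^ 2 / ((Q ^ 2 - Q + 2) * (Q ^ 2 + 1) ^ 2) by lra.
  apply: Rdiv_le_0_compat; last by apply: Rmult_lt_0_compat => //; apply: pow_lt.
  apply: Rmult_le_pos; [nra | exact: pow2_ge_0].
have {}z : Q * (Q + 1) <= Y * (Q ^ 2 + 1) by apply/Rle_div_l; lra.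
have -> : / Q * / Q = (Q - Y) / (Q ^ 2 * (Q - Y)) by field; lra.
have -> : (Y - 1) / (Q - Y) = (Q ^ 2 * (Y - 1)) / (Q ^ 2 * (Q - Y)) by field; lra.
apply: Rmult_le_compat_r; last lra.
by apply/Rlt_le/Rinv_0_lt_compat/Rmult_lt_0_compat; nra.
Qed.

Lemma rad2 : rad 2 = 2 / (Q * (Q - 1)).
Proof. by rewrite /rad Ysq /yW; field; repeat split; nra. Qed.

(** When S = 0, N / M = -1 / (q - 1) whatever the width, and this may lie outside the disc of radius
    [rad]. That alternative is needed for [TK2] and survives parallel composition. *)
Definition region (t : wtree) : Prop :=
  CM q t <> 0%C /\ ((Csd q t).1 = 0%C \/ Cmod (CN q t) <= rad (width t) * Cmod (CM q t)).

Lemma region_leV t : (width t <= n)%coq_nat -> region t ->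
  Cmod (CN q t) <= / Q * Cmod (CM q t).
Proof.
move=> wt [M0 [S0|h]].
  rewrite /CM /CN S0 -/Q.
  have -> : (0 - (Csd q t).2 = - (Csd q t).2)%C by ring.
  have -> : (0 + (q - 1) * (Csd q t).2 = (q - 1) * (Csd q t).2)%C by ring.
  rewrite Cmod_opp Cmod_mult -/Q; right; field; lra.
apply: (Rle_trans _ _ _ h); apply: Rmult_le_compat_r; first exact: Cmod_ge_0.
exact: rad_leV.
Qed.

Let q_neq0 : q <> 0%C.
Proof.
move=> q0; move: Q3; rewrite /Q q0.
have -> : (0 - 1 = - (1))%C by ring.
rewrite Cmod_opp Cmod_1; lra.
Qed.

Let q2_le : Cmod (q - 2)%C <= Q + 1.
Proof.
have -> : (q - 2 = (q - 1) + - (1))%C by ring.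
by apply: (Rle_trans _ _ _ (Cmod_triangle _ _)); rewrite Cmod_opp Cmod_1; right.
Qed.

Let q2_ge : Q - 1 <= Cmod (q - 2)%C.
Proof.
have : Cmod (q - 1)%C <= Cmod (q - 2)%C + 1.
  have {1}-> : (q - 1 = (q - 2) + 1)%C by ring.
  by apply: (Rle_trans _ _ _ (Cmod_triangle _ _)); rewrite Cmod_1; right.
rewrite -/Q; lra.
Qed.

(** A zero would force M1 M2 = -(q - 1) N1 N2, but the right-hand side has modulus at most |M1 M2| /
    Q. Only the separate widths are bounded by n here, which suits an outermost parallel
    composition. *)
Lemma CM_par_neq0 t1 t2 : (width t1 <= n)%coq_nat -> (width t2 <= n)%coq_nat ->
  region t1 -> region t2 -> CM q (TPar t1 t2) <> 0%C.
Proof.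
move=> w1 w2 R1 R2; have [M1 _] := R1; have [M2 _] := R2 => M0.
have n1 := region_leV _ w1 R1; have n2 := region_leV _ w2 R2.
move/Cmod_gt_0 in M1; move/Cmod_gt_0 in M2.
have := CM_par q t1 t2; rewrite M0 Cmult_0_r => E.
have : (CM q t1 * CM q t2 = - ((q - 1) * (CN q t1 * CN q t2)))%C.
  move: E; set m := (CM q t1 * CM q t2)%C; set x := ((q - 1) * _)%C => E.
  have -> : (m = (m + x) + - x)%C by ring.
  by rewrite -E; ring.
move/(congr1 Cmod); rewrite Cmod_opp !Cmod_mult -/Q.
have iQ : Q * / Q = 1 by field; lra.
have iQ1 : / Q <= / 3 by apply: Rinv_le_contravar; lra.
have : Q * (Cmod (CN q t1) * Cmod (CN q t2)) <=
       Q * ((/ Q * Cmod (CM q t1)) * (/ Q * Cmod (CM q t2))).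
  apply: Rmult_le_compat_l; first lra.
  by apply: Rmult_le_compat => //; apply: Cmod_ge_0.
have -> : Q * ((/ Q * Cmod (CM q t1)) * (/ Q * Cmod (CM q t2))) =
  / Q * (Cmod (CM q t1) * Cmod (CM q t2)) by field; lra.
have : 0 < Cmod (CM q t1) * Cmod (CM q t2) by apply: Rmult_lt_0_compat.
nra.
Qed.

Lemma region_par t1 t2 : (width t1 + width t2 <= n)%coq_nat ->
  region t1 -> region t2 -> region (TPar t1 t2).
Proof.
move=> w12 R1 R2.
have w1 : (width t1 <= n)%coq_nat by lia.
have w2 : (width t2 <= n)%coq_nat by lia.
split; first exact: CM_par_neq0.
(* If either factor has S = 0, so does the product. In the remaining case |q N| is bounded above and
   |q M| below by the triangle inequality, and [rad_add] matches the two bounds. *)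
move: R1 R2 => [_ [S1|n1]] [_ [S2|n2]];
  try by left; rewrite /= ?S1 ?S2; ring.
right; rewrite /=.
have q0 : 0 < Cmod q by apply/Cmod_gt_0.
apply: (Rmult_le_reg_l _ _ _ q0).
rewrite -Cmod_mult CN_par -Rmult_assoc (Rmult_comm (Cmod q)) Rmult_assoc -Cmod_mult CM_par.
set m1 := CM q t1; set m2 := CM q t2.
have p1 := rad_ge0 _ w1; have p2 := rad_ge0 _ w2.
have radE := rad_add _ _ w12; have p12 := rad_ge0 _ w12.
have a1 := Cmod_ge_0 m1; have a2 := Cmod_ge_0 m2.
have b1 := Cmod_ge_0 (CN q t1); have b2 := Cmod_ge_0 (CN q t2).
have nn : Cmod (CN q t1) * Cmod (CN q t2) <=
  rad (width t1) * rad (width t2) * (Cmod m1 * Cmod m2).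
  have -> : rad (width t1) * rad (width t2) * (Cmod m1 * Cmod m2) =
    (rad (width t1) * Cmod m1) * (rad (width t2) * Cmod m2) by ring.
  exact: Rmult_le_compat.
have upper : Cmod (CN q t1 * m2 + m1 * CN q t2 + (q - 2) * (CN q t1 * CN q t2))%C <=
  (rad (width t1) + rad (width t2) + (Q + 1) * (rad (width t1) * rad (width t2))) *
  (Cmod m1 * Cmod m2).
  apply: (Rle_trans _ _ _ (Cmod_triangle _ _)).
  apply: (Rle_trans _ _ _ (Rplus_le_compat_r _ _ _ (Cmod_triangle _ _))).
  rewrite !Cmod_mult.
  have : Cmod (CN q t1) * Cmod m2 <= rad (width t1) * Cmod m1 * Cmod m2.
    exact: Rmult_le_compat_r.
  have : Cmod m1 * Cmod (CN q t2) <= Cmod m1 * (rad (width t2) * Cmod m2).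
    exact: Rmult_le_compat_l.
  have : Cmod (q - 2)%C * (Cmod (CN q t1) * Cmod (CN q t2)) <=
    (Q + 1) * (rad (width t1) * rad (width t2) * (Cmod m1 * Cmod m2)).
    apply: Rmult_le_compat => //; [exact: Cmod_ge_0 | nra].
  lra.
have lower : (1 - Q * (rad (width t1) * rad (width t2))) * (Cmod m1 * Cmod m2) <=
  Cmod (m1 * m2 + (q - 1) * (CN q t1 * CN q t2))%C.
  have : Cmod (m1 * m2)%C <= Cmod (m1 * m2 + (q - 1) * (CN q t1 * CN q t2))%C
                             + Cmod ((q - 1) * (CN q t1 * CN q t2))%C.
    rewrite -(Cmod_opp ((q - 1) * _)).
    apply: Rle_trans (Cmod_triangle _ _); right; congr Cmod; ring.
  rewrite !Cmod_mult -/Q.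
  have := Rmult_le_compat_l Q _ _ ltac:(lra) nn; lra.
have := Rmult_le_compat_l _ _ _ p12 lower; rewrite -Rmult_assoc -radE.
exact: Rle_trans.
Qed.

Lemma region_ser t1 t2 : (0 < width t1)%coq_nat -> (0 < width t2)%coq_nat ->
  (width t1 <= n)%coq_nat -> (width t2 <= n)%coq_nat ->
  region t1 -> region t2 -> region (TSer t1 t2).
Proof.
move=> v1 v2 w1 w2 R1 R2; split.
  by rewrite CM_ser; apply: Cmult_neq_0; [case: R1 | case: R2].
right; rewrite CM_ser CN_ser !Cmod_mult.
have n1 := region_leV _ w1 R1; have n2 := region_leV _ w2 R2.
have iQ : 0 < / Q by apply: Rinv_0_lt_compat; lra.
have h : Cmod (CN q t1) * Cmod (CN q t2) <=
       (/ Q * Cmod (CM q t1)) * (/ Q * Cmod (CM q t2)).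
  by apply: Rmult_le_compat => //; apply: Cmod_ge_0.
apply: (Rle_trans _ _ _ h).
have -> : (/ Q * Cmod (CM q t1)) * (/ Q * Cmod (CM q t2)) =
  (/ Q * / Q) * (Cmod (CM q t1) * Cmod (CM q t2)) by ring.
apply: Rmult_le_compat_r; first by apply: Rmult_le_pos; apply: Cmod_ge_0.
(* The product of two bounds 1/Q fits the radius of width 1, and the width of a series composition
   is at least 1. *)
apply: (Rle_trans _ (rad 1)); first by apply: rad1; lia.
by apply: rad_mono => /=; lia.
Qed.

Lemma region_K2 : region TK2.
Proof.
split; last by left.
rewrite /CM /= => /(congr1 Cmod).
have -> : (0 + (q - 1) * 1 = q - 1)%C by ring.
rewrite Cmod_0 -/Q; lra.
Qed.

(** Here N / M = 2 / ((q - 1) (q - 2)) and |q - 2| >= Q - 1, so the bound is exactly [rad 2]. *)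
Lemma region_wheat : (2 <= n)%coq_nat -> region TWheat.
Proof.
move=> n2.
have ME : CM q TWheat = ((q - 1) * ((q - 2) * (q - 2)))%C.
  by rewrite /CM /=; ring.
have NE : CN q TWheat = (2 * (q - 2))%C by rewrite /CN /=; ring.
split.
  move/(congr1 Cmod); rewrite ME !Cmod_mult Cmod_0 -/Q; nra.
right; rewrite ME NE !Cmod_mult -/Q /= -/(rad 2) rad2.
have -> : Cmod 2 = 2 by rewrite Cmod_R Rabs_pos_eq; lra.
have := q2_ge; set z := Cmod (q - 2)%C => zge.
have -> : 2 / (Q * (Q - 1)) * (Q * (z * z)) = (2 * z) * (z / (Q - 1)) by field; lra.
have : 1 <= z / (Q - 1) by apply/Rle_div_r; lra.
nra.
Qed.

Lemma closed_region t : (2 <= n)%coq_nat -> closed_ok n.+1 t -> region t.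
Proof.
move=> n2; elim: t => [|||] /=.
- by move=> _; apply: region_K2.
- by move=> _; apply: region_wheat.
- move=> t1 IH1 t2 IH2 [/IH1 R1 /IH2 R2 w]; apply: region_par => //; lia.
move=> t1 IH1 t2 IH2 [c1 c2].
have w1 : (width t1 < n.+1)%N by apply: closed_ok_width => //; lia.
have w2 : (width t2 < n.+1)%N by apply: closed_ok_width => //; lia.
have := width_gt0 t1; have := width_gt0 t2.
by move=> *; apply: region_ser; (try lia); auto.
Qed.

(** Series composition multiplies M. At a parallel composition each side closes the other, so both
    sides lie in their regions. *)
Lemma open_CM_neq0 t : (2 <= n)%coq_nat -> open_ok n.+1 t -> CM q t <> 0%C.
Proof.
move=> n2; elim: t => [|||] /=.
- by move=> _; case: region_K2.
- by move=> _; case: (region_wheat n2).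
- move=> t1 IH1 t2 IH2 [c1 c2].
  have w1 : (width t1 < n.+1)%N by apply: closed_ok_width => //; lia.
  have w2 : (width t2 < n.+1)%N by apply: closed_ok_width => //; lia.
  by apply: CM_par_neq0; (try lia); apply: closed_region.
move=> t1 IH1 t2 IH2 [/IH1 h1 /IH2 h2]; rewrite CM_ser.
exact: Cmult_neq_0.
Qed.

End Regions.

Section Main.
Local Open Scope R_scope.

Lemma CP_neq0 (L : nat) (t : wtree) (q : C) : (3 <= L)%N -> open_ok L t ->
  ((INR L - ln (INR 2)) / ln (INR 2) <= Cmod (q - 1)%C) ->
  (q * CM q t)%C <> 0%C.
Proof.
case: L => [//|n] n3 ok; set Q := Cmod _ => bound.
have ln2_ge := ln2_ge; have ln2_le := ln2_le; have IN2 : INR 2 = 2 by rewrite /=; lra.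
have {}bound : (INR n.+1 <= (Q + 1) * ln 2).
  move: bound; rewrite IN2 => /Rle_div_l => h.
  have := h ltac:(lra); lra.
(* From 3 <= (Q + 1) ln 2 and ln 2 <= 3/4. *)
have Q3 : (3 <= Q).
  have : (INR 3 <= INR n.+1) by apply: le_INR; lia.
  rewrite [INR 3]/=; nra.
apply: Cmult_neq_0.
  move=> q0; move: Q3; rewrite /Q q0.
  have -> : (0 - 1 = - (1))%C by ring.
  rewrite Cmod_opp Cmod_1; lra.
apply: open_CM_neq0 ok => //; last by lia.
by apply: yW_pow_bound => //; rewrite -S_INR.
Qed.

End Main.
End Analytic.

(** * Colourings *)

Definition wf (G : tgraph) : bool :=
  [&& term_s G < nv G, term_t G < nv G, term_s G != term_t G &
      all (fun e => (e.1 < nv G) && (e.2 < nv G)) (edges G)].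

Section Colourings.

(** Edges carry plain natural numbers; a vertex out of range gets the colour [None]. *)
Definition colour {N : nat} {T : Type} (c : {ffun 'I_N -> T}) (v : nat) : option T :=
  omap c (insub v).

Arguments colour : simpl never.

Lemma colourE N (T : Type) (c : {ffun 'I_N -> T}) (v : 'I_N) : colour c v = Some (c v).
Proof. by rewrite /colour valK. Qed.

Definition proper_col {N : nat} {T : eqType} (E : seq (nat * nat)) (c : {ffun 'I_N -> T}) :=
  all (fun e => colour c e.1 != colour c e.2) E.

(** A colouring constant along [e] is determined by its values at the component roots, and these are
    arbitrary. *)
Lemma card_connect_invariant (V T : finType) (e : rel V) : connect_sym e ->
  #|[pred c : {ffun V -> T} | [forall x, forall y, e x y ==> (c x == c y)]]| =
  #|T| ^ n_comp e (@predT V).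
Proof.
move=> sym.
have -> : n_comp e (@predT V) = #|{: {x | roots e x}}|.
  by rewrite card_sig /n_comp_mem; apply: eq_card => x; rewrite !inE andbT.
rewrite -card_ffun.
pose ext (g : {ffun {x | roots e x} -> T}) :=
  [ffun v => g (exist _ (fingraph.root e v) (roots_root sym v))].
have ext_inj : injective ext.
  move=> g1 g2 /ffunP eg; apply/ffunP=> -[x rx]; have := eg x; rewrite !ffunE.
  suff rE : exist (roots e) (fingraph.root e x) (roots_root sym x) = exist (roots e) x rx.
    by rewrite rE.
  by apply: val_inj => /=; apply/eqP.
rewrite -(card_imset _ ext_inj); apply: eq_card => c; rewrite !inE.
apply/idP/imsetP.
  move=> inv; exists [ffun x => c (val x)] => //; apply/ffunP=> x; rewrite !ffunE /=.
  have /connectP[p pth ->] := connect_root e x.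
  elim: p x pth => //= y p IH x /andP[exy /IH <-].
  by apply/eqP; have /forallP/(_ y)/implyP := forallP inv x; apply.
case=> g _ ->; apply/forallP=> x; apply/forallP=> y; apply/implyP=> exy.
rewrite !ffunE; apply/eqP; congr (g _); apply: val_inj => /=.
by apply/eqP; rewrite root_connect // connect1.
Qed.

Definition pull {N N1 : nat} {T : Type} (g : nat -> nat)
    (gN : forall v, v < N1 -> g v < N) (c : {ffun 'I_N -> T}) : {ffun 'I_N1 -> T} :=
  [ffun v => c (Ordinal (gN _ (ltn_ord v)))].

Lemma colour_pull N N1 (T : Type) (g : nat -> nat) (gN : forall v, v < N1 -> g v < N)
  (c : {ffun 'I_N -> T}) v : v < N1 -> colour (pull g gN c) v = colour c (g v).
Proof.
move=> vN; rewrite -[v]/(val (Ordinal vN)) colourE ffunE -colourE.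
by congr colour; rewrite /=.
Qed.

(** Colourings of an amalgam correspond to pairs of colourings that agree on identified vertices.
    The last hypothesis makes every admissible pair agree, as happens when [P1] and [P2] prescribe
    the colours of the identified terminals. *)
Lemma card_glue (N N1 N2 : nat) (T : finType) (g1 g2 : nat -> nat)
    (g1N : forall v, v < N1 -> g1 v < N) (g2N : forall v, v < N2 -> g2 v < N)
    (P1 : pred {ffun 'I_N1 -> T}) (P2 : pred {ffun 'I_N2 -> T}) :
  {in [pred v | v < N1] &, injective g1} -> {in [pred v | v < N2] &, injective g2} ->
  (forall v, v < N -> (exists2 u, u < N1 & g1 u = v) \/ (exists2 u, u < N2 & g2 u = v)) ->
  (forall c1 c2, P1 c1 -> P2 c2 ->
     forall (x : 'I_N1) (y : 'I_N2), g1 x = g2 y -> c1 x = c2 y) ->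
  #|[pred c | P1 (pull g1 g1N c) && P2 (pull g2 g2N c)]| = #|P1| * #|P2|.
Proof.
move=> g1I g2I cov compat.
rewrite -cardX.
pose F (c : {ffun 'I_N -> T}) := (pull g1 g1N c, pull g2 g2N c).
have FI : injective F.
  move=> c d [] /ffunP e1 /ffunP e2; apply/ffunP=> v.
  case: (cov v (ltn_ord v)) => -[u uN guv].
    have := e1 (Ordinal uN); rewrite !ffunE /=.
    by rewrite (_ : Ordinal _ = v); last exact: val_inj.
  have := e2 (Ordinal uN); rewrite !ffunE /=.
  by rewrite (_ : Ordinal _ = v); last exact: val_inj.
rewrite -(card_image FI); apply: eq_card => -[c1 c2]; rewrite !inE /=.
apply/imageP/andP.
  by case=> c; rewrite !inE => /andP[] h1 h2 [-> ->].
case=> h1 h2.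
have cv (v : 'I_N) : exists x : T, (forall u : 'I_N1, g1 u = val v -> c1 u = x) /\
    (forall u : 'I_N2, g2 u = val v -> c2 u = x).
  case: (cov v (ltn_ord v)) => -[u uN guv].
    exists (c1 (Ordinal uN)); split=> w gw.
      by congr (c1 _); apply: val_inj; apply: g1I; rewrite ?inE //= gw.
    by apply/esym; apply: compat => //=; rewrite guv.
  exists (c2 (Ordinal uN)); split=> w gw.
    by apply: compat => //=; rewrite guv.
  by congr (c2 _); apply: val_inj; apply: g2I; rewrite ?inE //= gw.
(* The boolean form allows [xchoose] to select the common colour. *)
have {cv}cv (v : 'I_N) : exists x : T, [forall u : 'I_N1, (g1 u == val v) ==> (c1 u == x)] &&
    [forall u : 'I_N2, (g2 u == val v) ==> (c2 u == x)].
  have [x [xP1 xP2]] := cv v; exists x; apply/andP; split; apply/forallP=> u;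
    apply/implyP=> /eqP h; apply/eqP; [exact: xP1 | exact: xP2].
pose c := [ffun v => xchoose (cv v)].
have e1 : c1 = pull g1 g1N c.
  apply/ffunP=> u; rewrite !ffunE.
  have /andP[/forallP/(_ u)/implyP h _] := xchooseP (cv (Ordinal (g1N _ (ltn_ord u)))).
  by apply/eqP; apply: h => /=.
have e2 : c2 = pull g2 g2N c.
  apply/ffunP=> u; rewrite !ffunE.
  have /andP[_ /forallP/(_ u)/implyP h] := xchooseP (cv (Ordinal (g2N _ (ltn_ord u)))).
  by apply/eqP; apply: h => /=.
exists c; last by rewrite /F -e1 -e2.
by rewrite inE -e1 -e2; apply/andP.
Qed.

Lemma proper_pull N N1 (T : eqType) (g : nat -> nat) (gN : forall v, v < N1 -> g v < N)
    (c : {ffun 'I_N -> T}) E : all (fun e => (e.1 < N1) && (e.2 < N1)) E ->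
  proper_col E (pull g gN c) = proper_col [seq (g e.1, g e.2) | e <- E] c.
Proof.
move=> /allP wE; rewrite /proper_col all_map; apply: eq_in_all => e /wE /andP[h1 h2].
by rewrite /= !colour_pull.
Qed.

Definition colpred (G : tgraph) (n : nat) (a b : 'I_n) : pred {ffun 'I_(nv G) -> 'I_n} :=
  fun c => [&& colour c (term_s G) == Some a, colour c (term_t G) == Some b &
               proper_col (edges G) c].

Definition ncol (G : tgraph) (n : nat) (a b : 'I_n) : nat := #|colpred G n a b|.

End Colourings.

(** * Subset expansion of the number of proper colourings *)

Section Whitney.
Local Open Scope ring_scope.
Import GRing.Theory.
Variable F : comNzRingType.

(** The indicator of a proper colouring is the product over edges of 1 minus the indicator that the
    edge is monochromatic. Expanding over edge sets A and summing over colourings leaves those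
    constant along A, which number n^k(A). *)
Lemma whitney_expansion (G : tgraph) (n : nat) : wf G ->
  \sum_(A : {set 'I_(nedges G)}) (-1) ^+ #|A| * n%:R ^+ ncomp G A =
  (#|[pred c : {ffun 'I_(nv G) -> 'I_n} | proper_col (edges G) c]|)%:R :> F.
Proof.
case/and4P=> _ _ _ wE.
pose mono (c : {ffun 'I_(nv G) -> 'I_n}) (i : 'I_(nedges G)) :=
  colour c (edge_at G i).1 == colour c (edge_at G i).2.
have compE (A : {set 'I_(nedges G)}) :
  (n ^ ncomp G A)%N = #|[pred c | [forall i in A, mono c i]]|.
  have symA : symmetric (sub_adj G A).
    move=> x y; rewrite /sub_adj; apply: eq_existsb => i.
    by rewrite orbC.
  rewrite -[in LHS](card_ord n) -card_connect_invariant; last exact: sym_connect_sym.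
  apply: eq_card => c; rewrite !inE; apply/forallP/forall_inP => [h i iA|h x].
    have /andP[h1 h2] : ((edge_at G i).1 < nv G)%N && ((edge_at G i).2 < nv G)%N.
      by apply: (allP wE); apply: mem_nth.
    have /forallP/(_ (Ordinal h2))/implyP h' := h (Ordinal h1).
    rewrite /mono -[X in colour c X == _]/(val (Ordinal h1)).
    rewrite -[X in _ == colour c X]/(val (Ordinal h2)) !colourE.
    apply/eqP; congr Some; apply/eqP/h'.
    by apply/exists_inP; exists i => //=; rewrite -surjective_pairing eqxx.
  apply/forallP=> y; apply/implyP=> /exists_inP[i iA iE].
  have := h i iA; rewrite /mono.
  by case/orP: iE => /eqP-> /=; rewrite !colourE => /eqP[->].
under eq_bigr => A _ do rewrite -natrX compE.
have pullsum (A : {set 'I_(nedges G)}) :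
    (-1) ^+ #|A| * #|[pred c | [forall i in A, mono c i]]|%:R =
    \sum_(c : {ffun 'I_(nv G) -> 'I_n}) \prod_i (if i \in A then - (mono c i)%:R else 1) :> F.
  rewrite -[X in _ * X%:R]sum1_card natr_sum mulr_sumr big_mkcond /=.
  apply: eq_bigr => c _.
  rewrite -big_mkcond /= -[X in _ = X]/(\prod_(i in A) - (mono c i)%:R) inE.
  rewrite prodrN -natr_prod; case: ifP => [/forall_inP h|/negbT/forall_inPn[i iA ne]].
    by rewrite big1 // => i /h ->.
  by rewrite (bigD1 i) //= (negPf ne) mul0n mulr0.
under eq_bigr => A _ do rewrite pullsum.
rewrite exchange_big /= -sum1_card natr_sum [RHS]big_mkcond /=.
apply: eq_bigr => c _; rewrite inE.
have <- : \prod_i (- (mono c i)%:R + 1) = \sum_(A : {set 'I_(nedges G)})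
   \prod_i (if i \in A then - (mono c i)%:R else 1) :> F by rewrite bigA_distr.
have pE : proper_col (edges G) c = [forall i, ~~ mono c i].
  apply/(all_nthP (0, 0))/forallP => [h i|h i iN]; first exact: h.
  exact: (h (Ordinal iN)).
rewrite pE; case: ifP => [/forallP h|/negbT/forallPn[i /negPn ne]].
  by rewrite big1 // => i _; rewrite (negPf (h i)) oppr0 add0r.
by rewrite (bigD1 i) //= ne addNr mul0r.
Qed.

End Whitney.

(** * Colour counts of parallel and series compositions *)

Section Relabel.
Variables G1 G2 : tgraph.
Hypotheses (wf1 : wf G1) (wf2 : wf G2).

Lemma par_relabel_lt v : v < nv G2 -> par_relabel G1 G2 v < nv G1 + nv G2 - 2.
Proof.
case/and4P: wf1 => s1 t1 st1 _; case/and4P: wf2 => s2 t2 st2 _.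
by rewrite /par_relabel; case: eqP => h1; [|case: eqP => h2]; lia.
Qed.

Lemma par_relabel_inj : {in [pred v | v < nv G2] &, injective (par_relabel G1 G2)}.
Proof.
case/and4P: wf1 => s1 t1 st1 _; case/and4P: wf2 => s2 t2 st2 _.
move=> x y; rewrite !inE /par_relabel => xN yN.
by do ?[case: eqP => ?]; lia.
Qed.

Lemma par_relabel_cover v : v < nv G1 + nv G2 - 2 ->
  (exists2 u, u < nv G1 & id u = v) \/ (exists2 u, u < nv G2 & par_relabel G1 G2 u = v).
Proof.
case/and4P: wf1 => s1 t1 st1 _; case/and4P: wf2 => s2 t2 st2 _ vN.
have [v1|v1] := ltnP v (nv G1); first by left; exists v.
right; have [w wE] : exists w', w' = v - nv G1 by eexists.
have [u [uN us ut uw]] : exists u, [/\ u < nv G2, u <> term_s G2, u <> term_t G2 &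
    u - (term_s G2 < u) - (term_t G2 < u) = w].
  (* Both terminals of [G2] are skipped in the numbering, so the preimage is w, w + 1 or w + 2
     according to how many terminals precede it. *)
  have [wa|wa] := ltnP w (minn (term_s G2) (term_t G2)); first by exists w; split; lia.
  have [wb|wb] := ltnP w.+1 (maxn (term_s G2) (term_t G2)); first by exists w.+1; split; lia.
  by exists w.+2; split; lia.
by exists u => //; rewrite /par_relabel; do ?[case: eqP => // _]; rewrite uw; lia.
Qed.

Lemma par_relabel_glue x y : x < nv G1 -> y < nv G2 -> x = par_relabel G1 G2 y ->
  (x = term_s G1 /\ y = term_s G2) \/ (x = term_t G1 /\ y = term_t G2).
Proof.
move=> x1 y2; rewrite /par_relabel; case: eqP => h1; first by left.
by case: eqP => h2; [right | lia].
Qed.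

Lemma ser_relabel_lt v : v < nv G2 -> ser_relabel G1 G2 v < nv G1 + nv G2 - 1.
Proof.
case/and4P: wf1 => s1 t1 st1 _; case/and4P: wf2 => s2 t2 st2 _.
by rewrite /ser_relabel; case: eqP => h1; lia.
Qed.

Lemma ser_relabel_inj : {in [pred v | v < nv G2] &, injective (ser_relabel G1 G2)}.
Proof.
case/and4P: wf1 => s1 t1 st1 _; case/and4P: wf2 => s2 t2 st2 _.
move=> x y; rewrite !inE /ser_relabel => xN yN.
by do ?[case: eqP => ?]; lia.
Qed.

Lemma ser_relabel_cover v : v < nv G1 + nv G2 - 1 ->
  (exists2 u, u < nv G1 & id u = v) \/ (exists2 u, u < nv G2 & ser_relabel G1 G2 u = v).
Proof.
case/and4P: wf1 => s1 t1 st1 _; case/and4P: wf2 => s2 t2 st2 _ vN.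
have [v1|v1] := ltnP v (nv G1); first by left; exists v.
right; have [w wE] : exists w', w' = v - nv G1 by eexists.
have [wa|wa] := ltnP w (term_s G2); [exists w | exists w.+1]; try lia;
  rewrite /ser_relabel; case: eqP => ?; lia.
Qed.

Lemma ser_relabel_glue x y : x < nv G1 -> y < nv G2 -> x = ser_relabel G1 G2 y ->
  x = term_t G1 /\ y = term_s G2.
Proof. by move=> x1 y2; rewrite /ser_relabel; case: eqP => // h1; lia. Qed.

Lemma par_relabel_s : par_relabel G1 G2 (term_s G2) = term_s G1.
Proof. by rewrite /par_relabel eqxx. Qed.

Lemma par_relabel_t : par_relabel G1 G2 (term_t G2) = term_t G1.
Proof. by case/and4P: wf2 => _ _ st2 _; rewrite /par_relabel eqxx eq_sym (negPf st2). Qed.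

Lemma ser_relabel_s : ser_relabel G1 G2 (term_s G2) = term_t G1.
Proof. by rewrite /ser_relabel eqxx. Qed.

Lemma wf_parallel : wf (parallel G1 G2).
Proof.
case/and4P: wf1 => s1 t1 st1 e1; case/and4P: wf2 => s2 t2 st2 e2.
rewrite /wf /= st1 all_cat all_map; apply/and4P; split=> //; try lia.
apply/andP; split; first by apply: sub_all e1 => e /andP[]; lia.
by apply: sub_all e2 => e /= /andP[? ?]; rewrite !par_relabel_lt.
Qed.

Lemma wf_series : wf (series G1 G2).
Proof.
case/and4P: wf1 => s1 t1 st1 e1; case/and4P: wf2 => s2 t2 st2 e2.
rewrite /wf /= all_cat all_map; apply/and4P; split=> //.
- lia.
- exact: ser_relabel_lt.
- apply/eqP=> h; have [] := ser_relabel_glue _ _ s1 t2 h; lia.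
apply/andP; split; first by apply: sub_all e1 => e /andP[]; lia.
by apply: sub_all e2 => e /= /andP[? ?]; rewrite !ser_relabel_lt.
Qed.

Lemma emap_id (E : seq (nat * nat)) : [seq (id e.1, id e.2) | e <- E] = E.
Proof. by rewrite -[RHS]map_id; apply: eq_map => -[]. Qed.

Lemma ncol_parallel n (a b : 'I_n) :
  ncol (parallel G1 G2) n a b = ncol G1 n a b * ncol G2 n a b.
Proof.
case/and4P: (wf1) => s1 t1 st1 e1; case/and4P: (wf2) => s2 t2 st2 e2.
have g1N v : v < nv G1 -> id v < nv (parallel G1 G2) by move=> /=; lia.
have g2N v : v < nv G2 -> par_relabel G1 G2 v < nv (parallel G1 G2).
  exact: par_relabel_lt.
rewrite /ncol.
rewrite -(@card_glue _ _ _ _ _ _ g1N g2N (colpred G1 n a b) (colpred G2 n a b)).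
- apply: eq_card => c; rewrite !inE /in_mem /= /colpred !colour_pull //= !proper_pull //.
  rewrite emap_id /proper_col /= all_cat par_relabel_s par_relabel_t.
  by do !case: (_ == Some _) => //=; rewrite ?andbF.
- by move=> x y _ _.
- exact: par_relabel_inj.
- exact: par_relabel_cover.
move=> c1 c2 /and3P[/eqP cs1 /eqP ct1 _] /and3P[/eqP cs2 /eqP ct2 _] x y h.
apply: Some_inj; rewrite -!colourE.
by have [[-> ->]|[-> ->]] := par_relabel_glue _ _ (ltn_ord x) (ltn_ord y) h; rewrite ?cs1 ?ct1 ?cs2 ?ct2.
Qed.

Lemma ncol_series n (a b : 'I_n) :
  ncol (series G1 G2) n a b = \sum_m ncol G1 n a m * ncol G2 n m b.
Proof.
case/and4P: (wf1) => s1 t1 st1 e1; case/and4P: (wf2) => s2 t2 st2 e2.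
have g1N v : v < nv G1 -> id v < nv (series G1 G2) by move=> /=; lia.
have g2N v : v < nv G2 -> ser_relabel G1 G2 v < nv (series G1 G2).
  exact: ser_relabel_lt.
rewrite /ncol -sum1_card.
(* The sum runs over the colour m of the identified vertex; once it is fixed, the two sides are
   coloured independently. *)
rewrite (partition_big (fun c : {ffun _ -> _} => c (Ordinal (g1N _ t1))) predT) //=.
apply: eq_bigr => m _; rewrite sum1_card.
rewrite -(@card_glue _ _ _ _ _ _ g1N g2N (colpred G1 n a m) (colpred G2 n m b)).
- apply: eq_card => c; rewrite !inE /in_mem /= /colpred !colour_pull //= !proper_pull //.
  rewrite emap_id /proper_col /= all_cat ser_relabel_s.
  rewrite (_ : (c (Ordinal (g1N _ t1)) == m) = (colour c (term_t G1) == Some m)); last first.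
    by rewrite -[X in colour c X]/(val (Ordinal (g1N _ t1))) colourE.
  by do !case: (_ == Some _) => //=; rewrite ?andbF ?andbT.
- by move=> x y _ _.
- exact: ser_relabel_inj.
- exact: ser_relabel_cover.
move=> c1 c2 /and3P[/eqP cs1 /eqP ct1 _] /and3P[/eqP cs2 /eqP ct2 _] x y h.
apply: Some_inj; rewrite -!colourE.
by have [-> ->] := ser_relabel_glue _ _ (ltn_ord x) (ltn_ord y) h; rewrite ct1 cs2.
Qed.

End Relabel.

(** * Invariance under isomorphism *)

Section Iso.

Lemma all_norm (P : pred (nat * nat)) E : (forall x y, P (x, y) = P (y, x)) ->
  all P (map norm_edge E) = all P E.
Proof.
move=> symP; rewrite all_map; apply: eq_all => -[x y] /=.
by rewrite /norm_edge /=; case: leqP => // _; rewrite symP.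
Qed.

Variables G H : tgraph.
Hypothesis wfG : wf G.

Variable f : nat -> nat.
Hypotheses (nvE : nv G = nv H) (fI : {in [pred v | v < nv G] &, injective f})
  (fN : {in [pred v | v < nv G], forall v, f v < nv H})
  (fs : f (term_s G) = term_s H) (ft : f (term_t G) = term_t H)
  (fE : perm_eq [seq norm_edge (f e.1, f e.2) | e <- edges G]
                [seq norm_edge e | e <- edges H]).

Lemma iso_all (P : pred (nat * nat)) : (forall x y, P (x, y) = P (y, x)) ->
  all P (edges H) = all P [seq (f e.1, f e.2) | e <- edges G].
Proof.
move=> symP; rewrite -(all_norm _ _ symP) -(perm_all _ fE) -[RHS]all_norm //.
by rewrite -map_comp.
Qed.

Lemma wf_iso : wf H.
Proof.
case/and4P: wfG => s t st e; apply/and4P; split.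
- by rewrite -fs fN.
- by rewrite -ft fN.
- by rewrite -fs -ft; apply: contra st => /eqP/fI->.
rewrite iso_all; last by move=> x y /=; rewrite andbC.
by rewrite all_map; apply: sub_all e => x /= /andP[? ?]; rewrite !fN.
Qed.

Lemma ncol_iso n (a b : 'I_n) : ncol H n a b = ncol G n a b.
Proof.
case/and4P: (wfG) => s t st e.
have gN v : v < nv G -> f v < nv H by exact: fN.
have g0 v : v < 0 -> f v < nv H by [].
rewrite /ncol -[RHS]muln1.
(* The isomorphism is treated as a gluing with an empty network, which has exactly one colouring. *)
have <- : #|@predT {ffun 'I_0 -> 'I_n}| = 1 by rewrite card_ffun !card_ord expn0.
rewrite -(@card_glue _ _ _ _ _ _ gN g0 (colpred G n a b) predT) //.
- apply: eq_card => c; rewrite !inE /in_mem /= /colpred andbT !colour_pull //= !proper_pull //.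
  rewrite fs ft; congr [&& _, _ & _]; apply: iso_all => x y; by rewrite eq_sym.
- move=> v vH; left.
  (* Surjectivity of [f] comes from injectivity and the equal numbers of vertices. *)
  pose F (u : 'I_(nv G)) : 'I_(nv G) := cast_ord (esym nvE) (Ordinal (gN _ (ltn_ord u))).
  have FI : injective F.
    by move=> x y /(congr1 val) /= h; apply: val_inj; apply: fI h; rewrite inE ltn_ord.
  have vG : v < nv G by rewrite nvE.
  have [F' _ F'K] := injF_bij FI.
  exists (F' (Ordinal vG)) => //.
  by have /(congr1 val) := F'K (Ordinal vG).
by move=> c1 c2 _ _ x [].
Qed.

End Iso.

(** * Colour counts of the two basic networks *)

Section Base.

Lemma card_ffun_pred1 (T T' : finType) (P : pred {ffun T -> T'}) d :
  (forall c, P c -> c = d) -> #|P| = P d.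
Proof.
move=> h; case Pd: (P d); last first.
  by apply: eq_card0 => c; apply/negP=> cP; move: (cP); rewrite (h c cP) unfold_in Pd.
rewrite -[RHS](card1 d); apply: eq_card => c; rewrite !inE.
by apply/idP/eqP => [/h|->].
Qed.

Lemma eq_Some (T : eqType) (x y : T) : (Some x == Some y) = (x == y).
Proof. by apply/eqP/eqP => [[]|->]. Qed.

Lemma ncol_K2 n (a b : 'I_n) : ncol K2 n a b = (a != b).
Proof.
pose o k (h : k < 2) := Ordinal h.
have cE (c : {ffun 'I_2 -> 'I_n}) :
    colpred K2 n a b c = [&& c (o 0 isT) == a, c (o 1 isT) == b & c (o 0 isT) != c (o 1 isT)].
  have e0 : colour c 0 = Some (c (o 0 isT)) by rewrite -colourE.
  have e1 : colour c 1 = Some (c (o 1 isT)) by rewrite -colourE.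
  by rewrite /colpred /proper_col [all _ _]/= [term_s _]/= [term_t _]/= e0 e1 !eq_Some andbT.
rewrite /ncol (@card_ffun_pred1 _ _ _ [ffun v : 'I_2 => nth a [:: a; b] v]).
  by rewrite cE !ffunE /= !eqxx.
move=> c; rewrite cE => /and3P[/eqP c0 /eqP c1 _].
apply/ffunP=> -[[|[|//]] i]; rewrite ffunE /=; [rewrite -c0 | rewrite -c1];
  congr (c _); exact: val_inj.
Qed.

Lemma ncol_wheatstone n (a b : 'I_n) : ncol wheatstone n a b =
  \sum_(x | (x != a) && (x != b)) #|[pred y | [&& y != a, y != b & y != x]]|.
Proof.
pose o k (h : k < 4) := Ordinal h.
have cE (c : {ffun 'I_4 -> 'I_n}) :
    (c \in colpred wheatstone n a b) =
    [&& c (o 0 isT) == a, c (o 3 isT) == b, c (o 0 isT) != c (o 1 isT),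
        c (o 0 isT) != c (o 2 isT), c (o 1 isT) != c (o 2 isT),
        c (o 1 isT) != c (o 3 isT) & c (o 2 isT) != c (o 3 isT)].
  have e0 : colour c 0 = Some (c (o 0 isT)) by rewrite -colourE.
  have e1 : colour c 1 = Some (c (o 1 isT)) by rewrite -colourE.
  have e2 : colour c 2 = Some (c (o 2 isT)) by rewrite -colourE.
  have e3 : colour c 3 = Some (c (o 3 isT)) by rewrite -colourE.
  by rewrite unfold_in /colpred /proper_col [all _ _]/= [term_s _]/= [term_t _]/= e0 e1 e2 e3
             !eq_Some andbT.
rewrite /ncol -sum1_card.
rewrite (partition_big (fun c : {ffun 'I_4 -> _} => c (o 1 isT)) predT) //=.
rewrite [RHS]big_mkcond; apply: eq_bigr => x _.
rewrite (partition_big (fun c : {ffun 'I_4 -> _} => c (o 2 isT)) predT) //=.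
transitivity (\sum_(y < n) ([&& x != a, x != b, y != a, y != b & y != x] : nat)).
  apply: eq_bigr => y _.
  rewrite sum1_card (@card_ffun_pred1 _ _ _ [ffun v : 'I_4 => nth a [:: a; x; y; b] v]).
    rewrite cE !ffunE /= !eqxx !andbT /= (eq_sym a x) (eq_sym a y) (eq_sym x y).
    by case: (x != a) (x != b) (y != a) (y != b) (y != x) => [] [] [] [] [].
  move=> c; rewrite cE.
  case/andP=> /andP[/and3P[/eqP c0 /eqP c3 _] /eqP c1] /eqP c2.
  apply/ffunP=> -[[|[|[|[|//]]]] i]; rewrite ffunE /=;
    [rewrite -c0|rewrite -c1|rewrite -c2|rewrite -c3]; congr (c _); exact: val_inj.
case: ifP => [/andP[-> ->]|xab].
  by rewrite -sum1_card [RHS]big_mkcond /=; apply: eq_bigr => y _; rewrite unfold_in; case: ifP.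
by apply: big1 => y _; case: (x != a) (x != b) xab => [] [].
Qed.

End Base.

(** * The recursion for S and D over an arbitrary commutative ring *)

Section Counting.
Local Open Scope ring_scope.
Import GRing.Theory.
Import mathcomp.algebra_tactics.ring.

(** The ring is a parameter so that one recursion serves at natural numbers, at the indeterminate
    ['X] and at complex numbers; [rmorph_sd] moves between them. *)
Fixpoint sd (R : comNzRingType) (q : R) (t : wtree) : R * R :=
  match t with
  | TK2 => (0, 1)
  | TWheat => ((q - 1) * (q - 2%:R), (q - 2%:R) * (q - 3%:R))
  | TPar t1 t2 => ((sd R q t1).1 * (sd R q t2).1, (sd R q t1).2 * (sd R q t2).2)
  | TSer t1 t2 =>
      let: (S1, D1) := sd R q t1 in let: (S2, D2) := sd R q t2 in
      (S1 * S2 + (q - 1) * (D1 * D2), S1 * D2 + D1 * S2 + (q - 2%:R) * (D1 * D2))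
  end.

Lemma rmorph_sd (R R' : comNzRingType) (h : {rmorphism R -> R'}) q t :
  sd R' (h q) t = (h (sd R q t).1, h (sd R q t).2).
Proof.
elim: t => [||t1 IH1 t2 IH2|t1 IH1 t2 IH2] /=.
- by rewrite rmorph0 rmorph1.
- by rewrite !rmorphM !rmorphB rmorph1 !rmorph_nat.
- by rewrite IH1 IH2 /= !rmorphM.
rewrite IH1 IH2; case: (sd R q t1) (sd R q t2) => [S1 D1] [S2 D2] /=.
by rewrite !rmorphD !rmorphM !rmorphB rmorph1 rmorph_nat.
Qed.

Variable F : comNzRingType.

Lemma card_notin n (s : seq 'I_n) : uniq s ->
  #|[pred y | y \notin s]|%:R = n%:R - (size s)%:R :> F.
Proof.
move=> us; have := cardC [pred y | y \in s].
rewrite (card_uniqP us) card_ord => /(congr1 (fun k => k%:R : F)) <-.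
by rewrite natrD addrC addKr; congr (_%:R); apply: eq_card.
Qed.

Lemma natr_if (b : bool) (x y : F) : (if b then x else y) = y + b%:R * (x - y).
Proof. by case: b; rewrite ?mul0r ?addr0 // mul1r addrC subrK. Qed.

Lemma sum_delta n (a : 'I_n) (f : 'I_n -> F) : \sum_m (a == m)%:R * f m = f a.
Proof.
rewrite (bigD1 a) //= eqxx mul1r big1 ?addr0 // => m /negPf.
by rewrite eq_sym => ->; rewrite mul0r.
Qed.

Lemma sum_ser n (a b : 'I_n) (S1 D1 S2 D2 : F) :
  \sum_m (if a == m then S1 else D1) * (if m == b then S2 else D2) =
  if a == b then S1 * S2 + (n%:R - 1) * (D1 * D2)
  else S1 * D2 + D1 * S2 + (n%:R - 2%:R) * (D1 * D2).
Proof.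
have e m : (if a == m then S1 else D1) * (if m == b then S2 else D2) =
   D1 * D2 + (b == m)%:R * (D1 * (S2 - D2)) +
   (a == m)%:R * ((S1 - D1) * (if m == b then S2 else D2)).
  by rewrite (eq_sym b) !natr_if; ring.
under eq_bigr => m _ do rewrite e.
rewrite !big_split /= !sum_delta sumr_const card_ord -mulr_natl.
by case: eqP => _; ring.
Qed.

Lemma sum_sd n (S D : F) :
  \sum_(a < n) \sum_(b < n) (if a == b then S else D) = n%:R * (S + (n%:R - 1) * D).
Proof.
under eq_bigr => a _.
  under eq_bigr => b _ do rewrite natr_if.
  rewrite big_split /= sum_delta sumr_const card_ord -mulr_natl.
  over.
by rewrite sumr_const card_ord -mulr_natl; ring.
Qed.

Definition counts (G : tgraph) (t : wtree) := forall n (a b : 'I_n),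
  (ncol G n a b)%:R = if a == b then (sd F n%:R t).1 else (sd F n%:R t).2.

Lemma counts_K2 : counts K2 TK2.
Proof. by move=> n a b; rewrite ncol_K2 /=; case: eqP. Qed.

Lemma counts_wheatstone : counts wheatstone TWheat.
Proof.
move=> n a b; rewrite ncol_wheatstone natr_sum.
(* The set of terminal colours handles equal and distinct terminals together: one inner vertex has n
   - |s| choices and the other n - |s| - 1. *)
pose s := undup [:: a; b].
have us : uniq s by apply: undup_uniq.
have ins x : (x \notin s) = (x != a) && (x != b).
  by rewrite mem_undup !inE negb_or.
have sz : size s = (a != b).+1 by rewrite /s /= inE; case: eqP.
rewrite (eq_bigr (fun=> n%:R - (size s).+1%:R)); last first.
  move=> x; rewrite -ins => xs; rewrite -(card_notin n (x :: s)) /= ?xs //.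
  by congr (_%:R); apply: eq_card => y; rewrite !inE -/s negb_or ins andbA andbC.
rewrite sumr_const -[_ *+ #|_|]mulr_natl (_ : #|_| = #|[pred y | y \notin s]|); last first.
  by apply: eq_card => y; rewrite [RHS]inE ins.
rewrite card_notin // sz; by case: eqP => _ /=; ring.
Qed.

Lemma counts_par G1 G2 t1 t2 : wf G1 -> wf G2 ->
  counts G1 t1 -> counts G2 t2 -> counts (parallel G1 G2) (TPar t1 t2).
Proof.
by move=> w1 w2 c1 c2 n a b; rewrite ncol_parallel // natrM c1 c2 /=; case: eqP.
Qed.

Lemma counts_ser G1 G2 t1 t2 : wf G1 -> wf G2 ->
  counts G1 t1 -> counts G2 t2 -> counts (series G1 G2) (TSer t1 t2).
Proof.
move=> w1 w2 c1 c2 n a b; rewrite ncol_series // natr_sum.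
under eq_bigr => m _ do rewrite natrM c1 c2.
rewrite sum_ser /=.
by case: (sd F n%:R t1) (sd F n%:R t2) => [S1 D1] [S2 D2].
Qed.

Lemma sum_ncol G n : wf G ->
  #|[pred c : {ffun 'I_(nv G) -> 'I_n} | proper_col (edges G) c]| =
  (\sum_a \sum_b ncol G n a b)%N.
Proof.
case/and4P=> s t st e; rewrite -sum1_card.
rewrite (partition_big (fun c : {ffun _ -> _} => c (Ordinal s)) predT) //=.
apply: eq_bigr => a _.
rewrite (partition_big (fun c : {ffun _ -> _} => c (Ordinal t)) predT) //=.
apply: eq_bigr => b _; rewrite sum1_card /ncol; apply: eq_card => c.
have es : colour c (term_s G) = Some (c (Ordinal s)) by rewrite -colourE.
have et : colour c (term_t G) = Some (c (Ordinal t)) by rewrite -colourE.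
rewrite -[RHS]/(colpred G n a b c) /colpred es et !eq_Some unfold_in /= inE.
by rewrite -andbA andbC -andbA.
Qed.

Lemma whitney_sd G t n : wf G -> counts G t ->
  \sum_(A : {set 'I_(nedges G)}) (-1) ^+ #|A| * n%:R ^+ ncomp G A =
  n%:R * ((sd F n%:R t).1 + (n%:R - 1) * (sd F n%:R t).2).
Proof.
move=> wG cG; rewrite whitney_expansion // sum_ncol // natr_sum -sum_sd.
by apply: eq_bigr => a _; rewrite natr_sum; apply: eq_bigr => b _; rewrite cG.
Qed.

End Counting.

(** * From natural numbers of colours to arbitrary arguments *)

Section Polynomial.
Local Open Scope ring_scope.
Import GRing.Theory Num.Theory.

Lemma poly_eq_on_nat (F : numDomainType) (p q : {poly F}) :
  (forall n : nat, p.[n%:R] = q.[n%:R]) -> p = q.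
Proof.
move=> pq; apply/eqP; rewrite -subr_eq0; apply/eqP.
apply: (@roots_geq_poly_eq0 _ _ [seq i%:R | i <- iota 0 (size (p - q))]).
- by apply/allP=> _ /mapP[i _ ->]; rewrite /root hornerD hornerN pq subrr.
- by rewrite map_inj_uniq ?iota_uniq // => i j /eqP; rewrite eqr_nat => /eqP.
by rewrite size_map size_iota.
Qed.

(** Both sides are polynomials in z that agree at every natural number, hence coincide. *)
Lemma whitney_sd_complex (F : numDomainType) G t (z : F) :
  wf G -> counts F G t ->
  \sum_(A : {set 'I_(nedges G)}) (-1) ^+ #|A| * z ^+ ncomp G A =
  z * ((sd F z t).1 + (z - 1) * (sd F z t).2).
Proof.
move=> wG cG.
pose p : {poly F} := \sum_(A : {set 'I_(nedges G)}) (-1) ^+ #|A| * 'X ^+ ncomp G A.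
pose r : {poly F} := 'X * ((sd _ 'X t).1 + ('X - 1) * (sd _ 'X t).2).
have pE x : p.[x] = \sum_(A : {set 'I_(nedges G)}) (-1) ^+ #|A| * x ^+ ncomp G A.
  rewrite /p horner_sum; apply: eq_bigr => A _.
  by rewrite hornerM !horner_exp hornerN hornerC hornerX.
have rE x : r.[x] = x * ((sd F x t).1 + (x - 1) * (sd F x t).2).
  have := rmorph_sd _ _ (horner_eval x) 'X t; rewrite /= /horner_eval hornerX => ->.
  by rewrite /r hornerM hornerX hornerD hornerM hornerD hornerX hornerN hornerC.
by rewrite -pE -rE (poly_eq_on_nat _ p r) // => n; rewrite pE rE (whitney_sd _ _ t).
Qed.

End Polynomial.

(** * Construction trees for the members of the class *)

(** The invariant carried through the construction of the class. The virtual edge between the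
    terminals in the third clause stands for a path outside the network. *)
Definition tree_of (F : comNzRingType) (G : tgraph) (t : wtree) : Prop :=
  [/\ wf G, flow id (edges G) (term_s G) (term_t G) (width t),
      forall L, cap ((term_s G, term_t G) :: edges G) L -> closed_ok L t,
      forall L, cap (edges G) L -> open_ok L t & counts F G t].

Lemma flow1 E x y k : 0 < k -> flow (@id (nat * nat)) E x y k -> conn id E x y.
Proof.
case: k => //= k _ [E1 [E2 [p c _]]].
by apply: conn_perm p _; apply: conn_catl.
Qed.

Lemma verts_wf G x : wf G -> x \in verts (edges G) -> x < nv G.
Proof.
case/and4P=> _ _ _ /allP e; rewrite /verts mem_cat.
by case/orP=> /mapP[f /e /andP[h1 h2] ->].
Qed.

Lemma verts_wf_cons G x : wf G ->
  x \in verts ((term_s G, term_t G) :: edges G) -> x < nv G.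
Proof.
move=> wG; case/and4P: (wG) => s t _ _; rewrite /verts mem_cat /= !inE.
by case/orP=> /orP[/eqP->//|xE]; apply: verts_wf wG _; rewrite /verts mem_cat xE ?orbT.
Qed.

Lemma cap_emap_wf f G L : wf G -> {in [pred v | v < nv G] &, injective f} ->
  cap ((f (term_s G), f (term_t G)) :: map (emap f) (edges G)) L ->
  cap ((term_s G, term_t G) :: edges G) L.
Proof.
move=> wG fI; apply: (@cap_emap f ((_, _) :: _)).
by move=> x y /(verts_wf_cons _ _ wG) xN /(verts_wf_cons _ _ wG) yN; apply: fI; rewrite inE.
Qed.

Lemma cap_emap_wf_edges f G L : wf G -> {in [pred v | v < nv G] &, injective f} ->
  cap (map (emap f) (edges G)) L -> cap (edges G) L.
Proof.
move=> wG fI; apply: cap_emap.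
by move=> x y /(verts_wf _ _ wG) xN /(verts_wf _ _ wG) yN; apply: fI; rewrite inE.
Qed.

Lemma tree_of_par F G1 G2 t1 t2 : tree_of F G1 t1 -> tree_of F G2 t2 ->
  tree_of F (parallel G1 G2) (TPar t1 t2).
Proof.
case=> w1 f1 c1 o1 k1 [w2 f2 c2 o2 k2].
have g2I := par_relabel_inj _ _ w1 w2.
have gs : par_relabel G1 G2 (term_s G2) = term_s G1 by exact: par_relabel_s.
have gt : par_relabel G1 G2 (term_t G2) = term_t G1 by exact: par_relabel_t.
have fl2 := flow_emap (par_relabel G1 G2) _ _ _ _ f2; rewrite gs gt in fl2.
have fl : flow id (edges (parallel G1 G2)) (term_s G1) (term_t G1) (width t1 + width t2).
  exact: flow_cat.
have close2 L : cap ((term_s G1, term_t G1) :: map (emap (par_relabel G1 G2)) (edges G2)) L ->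
    closed_ok L t2.
  by move=> cL; apply: c2; apply: cap_emap_wf g2I _ => //; rewrite gs gt.
split=> /=; [exact: wf_parallel | done | | | exact: counts_par].
  move=> L cL; split.
  - by apply: c1; apply: (@cap_catl (_ :: _) _ _ cL).
  - apply: close2; apply: (@cap_catl (_ :: _) (edges G1)); apply: cap_perm cL.
    by rewrite /= perm_cons perm_catC.
  (* The virtual edge is one more connection, disjoint from the width t1 + width t2 others, hence
     the strict bound. *)
  case/and4P: w1 => _ _ st _; apply: (cL (term_s G1) (term_t G1)) => //.
  exists [:: (term_s G1, term_t G1)], (edges (parallel G1 G2)); split=> //.
  by move=> c /=; rewrite andbT => /eqP.
move=> L cL; split.
  (* The second network joins the terminals, so it can play the virtual edge that closes the
     first. *)
  apply: c1; apply: cap_subst (_ : conn id (map (emap (par_relabel G1 G2)) (edges G2)) _ _) _.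
    by apply: flow1 fl2; exact: width_gt0.
  by apply: cap_perm cL; rewrite perm_catC.
apply: close2; apply: cap_subst cL; apply: flow1 f1; exact: width_gt0.
Qed.

Lemma tree_of_ser F G1 G2 t1 t2 : tree_of F G1 t1 -> tree_of F G2 t2 ->
  tree_of F (series G1 G2) (TSer t1 t2).
Proof.
case=> w1 f1 c1 o1 k1 [w2 f2 c2 o2 k2].
have g2I := ser_relabel_inj _ _ w1 w2.
have gs : ser_relabel G1 G2 (term_s G2) = term_t G1 by exact: ser_relabel_s.
set g := ser_relabel G1 G2 in g2I gs *.
have fl2 := flow_emap g _ _ _ _ f2; rewrite gs in fl2.
have cn1 : conn id (edges G1) (term_s G1) (term_t G1) by apply: flow1 f1; exact: width_gt0.
have cn2 : conn id (map (emap g) (edges G2)) (term_t G1) (g (term_t G2)).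
  by apply: flow1 fl2; exact: width_gt0.
split=> /=; [exact: wf_series | | | | exact: counts_ser].
- apply: flow_conn_trans; [apply: flow_le f1 | apply: flow_le fl2]; lia.
- move=> L cL; split.
    (* The outside path continued through the second network closes the first; the second is closed
       symmetrically. *)
    apply: c1; apply: (@cap_subst _ _ ((term_s G1, g (term_t G2)) :: map (emap g) (edges G2))).
      move=> c /= /andP[/eqP-> /cn2 h]; by rewrite h.
    by apply: cap_perm cL; rewrite /= perm_cons perm_catC.
  apply: c2; apply: (@cap_emap_wf g) => //; rewrite gs.
  apply: (@cap_subst _ _ ((term_s G1, g (term_t G2)) :: edges G1)) => //.
  by move=> c /= /andP[/eqP <- /cn1 ->].
move=> L cL; split; first by apply: o1; apply: cap_catl cL.
apply: o2; apply: (@cap_emap_wf_edges g) => //; apply: (@cap_catl _ (edges G1)).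
by apply: cap_perm cL; rewrite perm_catC.
Qed.

Lemma tree_of_iso F G H t : tg_iso G H -> tree_of F G t -> tree_of F H t.
Proof.
case=> nvE [f [fI [fN [fs [ft fE]]]]] [w fl c o k].
have eE : perm_eq (map norm_edge (map (emap f) (edges G))) (map norm_edge (edges H)).
  by rewrite -map_comp.
split.
- exact: wf_iso fE.
- by rewrite -fs -ft; apply: flow_norm_perm eE _; exact: flow_emap.
- move=> L cL; apply: c; apply: (@cap_emap_wf f) => //; rewrite fs ft.
  by apply: cap_norm_perm cL; rewrite /= perm_cons.
- move=> L cL; apply: o; apply: (@cap_emap_wf_edges f) => //.
  exact: cap_norm_perm cL.
by move=> n a b; rewrite (ncol_iso G H w f).
Qed.

Lemma inW_tree_of (F : comNzRingType) G : inW G -> exists t, tree_of F G t.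
Proof.
elim=> [||G1 G2 _ [t1 h1] _ [t2 h2]|G1 G2 _ [t1 h1] _ [t2 h2]|G1 H _ [t h] iso].
- exists TK2; split=> //; last exact: counts_K2.
  exists [:: (0, 1)], [::]; split=> //.
  by move=> c /=; rewrite andbT => /eqP.
- exists TWheat; split=> //; last exact: counts_wheatstone.
  (* The two disjoint paths are 0-1-3 and 0-2-3; the edge between 1 and 2 is left over. *)
  exists [:: (0, 1); (1, 3)], [:: (0, 2); (2, 3); (1, 2)]; split=> //.
    by move=> c /= /and3P[/eqP-> /eqP->].
  exists [:: (0, 2); (2, 3)], [:: (1, 2)]; split=> //.
  by move=> c /= /and3P[/eqP-> /eqP->].
- by exists (TPar t1 t2); apply: tree_of_par.
- by exists (TSer t1 t2); apply: tree_of_ser.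
by exists t; apply: tree_of_iso h.
Qed.

Lemma cap_maxmaxflow G L : wf G -> maxmaxflow G <= L -> cap (edges G) L.
Proof.
move=> wG mL x y [|k] xy // fl.
have vx u v : u != v -> flow id (edges G) u v k.+1 -> u < nv G.
  by move=> uv fuv; apply: (verts_wf _ _ wG); apply: (flow_verts _ _ _ k.+1 uv isT fuv).
have xN := vx _ _ xy fl.
have yN : y < nv G by apply: (vx y x); rewrite 1?eq_sym //; exact: flow_sym.
apply: leq_trans (flow_lambda _ _ _ _ xy fl) _; apply: leq_trans mL.
apply: leq_trans (leq_bigmax (Ordinal xN)).
by apply: (@leq_bigmax_cond _ _ (fun v : 'I_(nv G) => lambda G x v) (Ordinal yN)).
Qed.

(** * Agreement of the three representations of complex numbers *)

Section Bridge.
Import GRing.Theory.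
Local Open Scope ring_scope.

Definition to_cplx (z : R[i]) : cplx := let: Complex a b := z in (a, b).

Lemma to_cplxD z w : to_cplx (z + w) = Cadd (to_cplx z) (to_cplx w).
Proof. by case: z w => [a b] [c d]. Qed.

Lemma to_cplxM z w : to_cplx (z * w) = Cmul (to_cplx z) (to_cplx w).
Proof. by case: z w => [a b] [c d]. Qed.

Lemma to_cplxX z n : to_cplx (z ^+ n) = Cpow (to_cplx z) n.
Proof. by elim: n => [//|n IH]; rewrite exprS to_cplxM IH. Qed.

Lemma to_cplxN1 : to_cplx (-1) = Cminus_one.
Proof. by congr pair; rewrite oppr0. Qed.

Lemma chrom_eval_to_cplx G z :
  chrom_eval G (to_cplx z) =
  to_cplx (\sum_(A : {set 'I_(nedges G)}) (-1) ^+ #|A| * z ^+ ncomp G A).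
Proof.
rewrite (big_morph to_cplx to_cplxD (erefl : to_cplx 0 = C0)).
by apply: eq_bigr => A _; rewrite to_cplxM !to_cplxX to_cplxN1.
Qed.

Lemma to_cplxB z w : to_cplx (z - w) = Coquelicot.Complex.Cminus (to_cplx z) (to_cplx w).
Proof. by case: z w => [a b] [c d]. Qed.

Lemma to_cplx_nat n : to_cplx n%:R = Coquelicot.Complex.RtoC (INR n).
Proof.
elim: n => [//|n IH]; rewrite -addn1 natrD to_cplxD IH plus_INR /=.
by rewrite /Cadd /= /Coquelicot.Complex.RtoC; congr pair; exact: Rplus_0_l.
Qed.

Lemma Csd_to_cplx z t : Analytic.Csd (to_cplx z) t =
  (to_cplx (sd _ z t).1, to_cplx (sd _ z t).2).
Proof.
have e1 : to_cplx 1 = Coquelicot.Complex.RtoC 1 by [].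
have e2 : to_cplx 2%:R = Coquelicot.Complex.RtoC 2.
  by rewrite to_cplx_nat; congr pair; rewrite /=; Lra.lra.
have e3 : to_cplx 3%:R = Coquelicot.Complex.RtoC 3.
  by rewrite to_cplx_nat; congr pair; rewrite /=; Lra.lra.
have M x y : to_cplx (x * y) = Coquelicot.Complex.Cmult (to_cplx x) (to_cplx y).
  exact: to_cplxM.
have D x y : to_cplx (x + y) = Coquelicot.Complex.Cplus (to_cplx x) (to_cplx y).
  exact: to_cplxD.
elim: t => [||t1 IH1 t2 IH2|t1 IH1 t2 IH2] /=.
- by [].
- by rewrite !M !to_cplxB e1 e2 e3.
- by rewrite IH1 IH2 /= !M.
rewrite IH1 IH2; case: (sd _ z t1) (sd _ z t2) => [S1 D1] [S2 D2] /=.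
by rewrite !D !M !to_cplxB e1 e2.
Qed.

End Bridge.

Theorem theorem1p6 (L : nat) (G : tgraph) :
  3 <= L -> inW G -> maxmaxflow G <= L ->
  forall q : cplx, chrom_eval G q = C0 ->
    Rlt (Cmod (Cadd q Cminus_one)) (Rdiv (Rminus (INR L) (ln (INR 2))) (ln (INR 2))).
Proof.
move=> L3 GW GL q; have [t [wG _ _ ok cnt]] := inW_tree_of R[i]%C G GW.
have {}ok := ok L (cap_maxmaxflow _ _ wG GL).
case: q => x y; rewrite -[(x, y)]/(to_cplx (Complex x y)); set z := Complex x y.
rewrite chrom_eval_to_cplx (whitney_sd_complex _ _ t) // => root.
(* Were |q - 1| at least the bound, [CP_neq0] would make q M nonzero, whereas q M equals the
   chromatic polynomial at its root q. *)
apply: Rnot_le_lt => bound; apply: (Analytic.CP_neq0 L t (to_cplx z) L3 ok).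
  have -> : Coquelicot.Complex.Cmod
      (Coquelicot.Complex.Cminus (to_cplx z) (Coquelicot.Complex.RtoC 1)) =
    Cmod (Cadd (to_cplx z) Cminus_one).
    rewrite /Coquelicot.Complex.Cmod /Cmod !Rsqr_pow2; congr (sqrt (_ ^ 2 + _ ^ 2)).
    by rewrite /= Ropp_0.
  exact: bound.
rewrite -[RHS]root /Analytic.CM Csd_to_cplx to_cplxM to_cplxD to_cplxM to_cplxB.
by [].
Qed.
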